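(* Let a Lie group $G$ act smoothly on the right of a manifold $M$ and let $\mathcal{G}=(P,Y)$ be a bundle gerbe over $M$. A strong action of $G$ on $\mathcal{G}$ induces a weak action of $G$ on $\mathcal{G}$, i.e. a simplicial extension of $\mathcal{G}$ over the simplicial manifold $EG(M)_\bullet$.
   Context: All manifolds and maps are smooth; $f^{-1}$ denotes pullback of bundles. $EG(M)_\bullet$ is the simplicial manifold $EG(M)_n=M\times G^n$ with $d_0(m,g_1,\dots,g_n)=(mg_1,g_2,\dots,g_n)$, $d_k(m,g_1,\dots,g_n)=(m,g_1,\dots,g_kg_{k+1},\dots,g_n)$ for $0<k<n$, $d_n(m,g_1,\dots,g_n)=(m,g_1,\dots,g_{n-1})$. For a simplicial manifold $X_\bullet$ with face maps $d_i$ and a $U(1)$-bundle $Q\to X_p$, $\delta(Q)=d_0^{-1}(Q)\otimes d_1^{-1}(Q)^*\otimes d_2^{-1}(Q)\otimes\cdots\to X_{p+1}$, and similarly for sections; $\delta^2(Q)$ has a canonical section $1$, since its factors pair up as $Q\otimes Q^*$. A simplicial surjective submersion $Y_\bullet\to X_\bullet$ is a simplicial map with each $Y_k\to X_k$ a surjective submersion. A bundle gerbe $(P,Y)$ over $M$ is a surjective submersion $Y\to M$ and a $U(1)$-bundle $P\to Y^{[2]}=Y\times_MY$ with an associative product $P_{(y_1,y_2)}\otimes P_{(y_2,y_3)}\to P_{(y_1,y_3)}$. A trivialisation is a $U(1)$-bundle $T\to Y$ with an isomorphism $\delta_Y(T)\cong P$ respecting products, where $\delta_Y(T)_{(y_1,y_2)}=T_{y_2}\otimes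 T_{y_1}^*$. A strong action of $G$ on $(P,Y)$ is a smooth action of $G$ on $Y$ covering the action on $M$ together with a smooth action of $G$ on $P\to Y^{[2]}$ by bundle morphisms covering the induced action on $Y^{[2]}$ and commuting with the bundle gerbe product. Given $Y_\bullet\to X_\bullet$ and a bundle gerbe $\mathcal{G}=(P,Y_0)$ over $X_0$: $\delta(\mathcal{G})=(\delta(P),Y_1)$ is the bundle gerbe over $X_1$ with $\delta(P)=d_0^{-1}(P)\otimes d_1^{-1}(P)^*\to Y_1^{[2]}$ (pullbacks by the induced maps $Y_1^{[2]}\to Y_0^{[2]}$); $\delta^2(\mathcal{G})=(\delta^2(P),Y_2)$ over $X_2$ is canonically isomorphic to the trivial bundle $Y_2^{[2]}\times U(1)$ with trivial product. If $T\to Y_1$ trivialises $\delta(\mathcal{G})$, then $\delta(T)\to Y_2$ trivialises $\delta^2(\mathcal{G})$ and hence descends to a $U(1)$-bundle $A_T\to X_2$; the canonical section of $\delta^2(T)$ descends to a canonical section $1$ of $\delta(A_T)$. A simplicial extension of $\mathcal{G}$ over $X_\bullet$ is a triple $(Y_\bullet,T,s)$: a simplicial surjective submersion $Y_\bullet\to X_\bullet$ extending $Y_0\to X_0$, a trivialisation $T\to Y_1$ of $\delta(\mathcal{G})$, and a section $s$ of $A_T\to X_2$ with $\delta(s)=1$. A weak action of $G$ on $\mathcal{G}$ is a simplicial extension of $\mathcal{G}$ over $EG(M)_\bullet$. The induced weak action meant here is $(EG(Y)_\bullet,T,s)$ where $T=(Y\times G)\times U(1)$ is the trivial bundle, regarded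 as a trivialisation of $\delta(\mathcal{G})$ through the isomorphism $P_{(y_1,y_2)}^*\otimes P_{(y_1g,y_2g)}\cong P_{(y_1,y_2)}^*\otimes P_{(y_1,y_2)}\cong U(1)$ given by the action of $g^{-1}$, and $s$ is the canonical section of the trivial bundle $A_T$. *)

(* Defs.v *)
From HB Require Import structures.
From Stdlib Require Import Relations.
From mathcomp Require Import all_boot all_order all_algebra.
From mathcomp Require Import complex.
From mathcomp Require Import all_classical all_reals topology normedtype.
From mathcomp Require Import landau derive.
Set Implicit Arguments.
Unset Strict Implicit.
Unset Printing Implicit Defensive.
Import Order.TTheory GRing.Theory Num.Theory.
Import numFieldNormedType.Exports.
Local Open Scope classical_set_scope.
Local Open Scope ring_scope.

Section Calculus.
Context {R : realType}.

(* f is of class C^k at the points of the open set U *)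
Fixpoint Ck (k : nat) n (U : set 'rV[R]_n) (f : 'rV[R]_n -> R) : Prop :=
  if k is k'.+1 then
    (forall x, U x -> differentiable f x) /\
    (forall v, Ck k' U (fun x => 'D_v f x))
  else forall x, U x -> {for x, continuous f}.

Definition smooth_on m n (U : set 'rV[R]_m) (f : 'rV[R]_m -> 'rV[R]_n) :=
  forall k j, Ck k U (fun x => f x 0 j).

Lemma near_eq_differentiable (V : normedModType R) (f g : V -> R) (x : V) :
  (\near x, f x = g x) -> differentiable f x -> differentiable g x.
Proof.
move=> fg df; pose h := g - f.
have -> : g = f + h by rewrite /h addrC subrK.
apply: differentiableD => //.
have h0 : \near x, h x = 0.
  by apply: filterS fg => y fgy; rewrite /h !fctE fgy subrr.
have hx0 : h x = 0 by exact: nbhs_singleton h0.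
have E : h \o shift x = cst (h x) + \0 +o_ (0 : V) id.
  rewrite hx0; apply/eqaddoP => e e0.
  have h0' : \forall y \near (0:V), h (y + x) = 0.
    by move: h0; rewrite (near_shift (0 : V)) subr0.
  apply: filterS h0' => y hy; rewrite !fctE /= hy addr0 subr0 normr0.
  by apply: mulr_ge0; [exact: ltW|exact: normr_ge0].
have D : 'd h x = \0 :> (V -> R).
  by apply: diff_unique => //; exact: cst_continuous.
by apply/diff_locallyP; rewrite D; split => //; exact: cst_continuous.
Qed.

Lemma Ck_ext k n (U : set 'rV[R]_n) f g :
  open U -> (forall x, U x -> f x = g x) -> Ck k U f -> Ck k U g.
Proof.
move=> Uo; elim: k f g => [|k IH] f g fg /=.
  move=> Cf x Ux; have E : \near x, f x = g x.
    by near=> y; apply: fg; near: y; exact: open_nbhs_nbhs.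
  have Hf : f @ x --> f x := Cf x Ux.
  change (g @ x --> g x); rewrite -(fg x Ux).
  apply: cvg_trans Hf; apply: (@near_eq_cvg _ _ (nbhs x)).
  by apply: filterS E => y ->.
case=> df Df; split.
  move=> x Ux; have E : \near x, f x = g x.
    by near=> y; rewrite fg //; near: y; exact: open_nbhs_nbhs.
  exact: near_eq_differentiable E (df x Ux).
move=> v; apply: IH (Df v) => x Ux; apply: near_eq_derive.
by near=> y; apply: fg; near: y; exact: open_nbhs_nbhs.
Unshelve. all: by end_near. Qed.

Lemma CkW k n (U : set 'rV[R]_n) f : Ck k.+1 U f -> Ck k U f.
Proof.
elim: k f => [|k IH] f [df Df].
  by move=> x /df; exact: differentiable_continuous.
by split => // v; exact: IH.
Qed.

Lemma CkS k n (U V : set 'rV[R]_n) f : V `<=` U -> Ck k U f -> Ck k V f.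
Proof.
move=> VU; elim: k f => [|k IH] f /=; first by move=> Cf x /VU; exact: Cf.
by case=> df Df; split => [x /VU/df//|v]; exact: IH.
Qed.

Lemma Ck_cst k n (U : set 'rV[R]_n) (c : R) : Ck k U (fun=> c).
Proof.
elim: k c => [|k IH] c /=; first by move=> x _; exact: cst_continuous.
split=> [x _|v]; first exact: differentiable_cst.
by under eq_fun do rewrite derive_cst.
Qed.

Lemma CkD k n (U : set 'rV[R]_n) f g : open U ->
  Ck k U f -> Ck k U g -> Ck k U (fun x => f x + g x).
Proof.
move=> Uo; elim: k f g => [|k IH] f g /=.
  by move=> Cf Cg x Ux; apply: continuousD; [exact: Cf|exact: Cg].
move=> [df Df] [dg Dg]; split=> [x Ux|v].
  by apply: differentiableD; [exact: df|exact: dg].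
apply: Ck_ext (IH _ _ (Df v) (Dg v)) => // x Ux.
by rewrite -deriveD //; apply: diff_derivable; [exact: df|exact: dg].
Qed.

Lemma CkM k n (U : set 'rV[R]_n) f g : open U ->
  Ck k U f -> Ck k U g -> Ck k U (fun x => f x * g x).
Proof.
move=> Uo; elim: k f g => [|k IH] f g.
  by move=> Cf Cg x Ux; exact: (continuousM (Cf x Ux) (Cg x Ux)).
move=> Cf Cg; have [df Df] := Cf; have [dg Dg] := Cg; split=> [x Ux|v].
  exact: differentiableM (df x Ux) (dg x Ux).
have := CkD Uo (IH _ _ (CkW Cf) (Dg v)) (IH _ _ (CkW Cg) (Df v)).
apply: Ck_ext => // x Ux.
have dfx : derivable f x v by exact: diff_derivable (df x Ux).
have dgx : derivable g x v by exact: diff_derivable (dg x Ux).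
by rewrite -[LHS]/(f x *: 'D_v g x + g x *: 'D_v f x) -deriveM.
Qed.

Lemma Ck_sum k n p (U : set 'rV[R]_n) (f : 'I_p -> 'rV[R]_n -> R) : open U ->
  (forall i, Ck k U (f i)) -> Ck k U (fun x => \sum_i f i x).
Proof.
move=> Uo; elim: p f => [|p IH] f Cf.
  by under eq_fun do rewrite big_ord0; exact: Ck_cst.
by under eq_fun do rewrite big_ord_recl; apply: CkD => //; exact: IH.
Qed.

Lemma differentiable_rV m n (h : 'rV[R]_m -> 'rV[R]_n) x :
  (forall j, differentiable (fun x => h x 0 j) x) -> differentiable h x.
Proof.
move=> dh; have -> : h = \sum_(j < n) (fun x => h x 0 j *: delta_mx 0 j).
  by apply/funext => y; rewrite fct_sumE -row_sum_delta.
by apply: differentiable_sum => j; exact: differentiableZl.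
Qed.

Lemma Ck_comp k m n (U : set 'rV[R]_n) (V : set 'rV[R]_m) f
    (h : 'rV[R]_m -> 'rV[R]_n) : open V -> smooth_on V h ->
  (forall x, V x -> U (h x)) -> Ck k U f -> Ck k V (f \o h).
Proof.
move=> Vo hs hVU; have dh x (Vx : V x) : differentiable h x.
  by apply: differentiable_rV => j; exact: (hs 1%N j).1 x Vx.
elim: k f => [|k IH] f.
  move=> Cf x Vx; apply: continuous_comp; last exact/Cf/hVU.
  exact/differentiable_continuous/dh.
move=> Cf; have [df Df] := Cf; split=> [x Vx|v].
  by apply: differentiable_comp; [exact: dh|exact/df/hVU].
have : Ck k V (fun x => \sum_j 'D_v (fun x => h x 0 j) x *
                          ((fun y => 'D_(delta_mx 0 j) f y) \o h) x).
  apply: Ck_sum => // j; apply: CkM => //; last exact: (IH _ (Df _)).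
  by case: (hs k.+1 j) => _; apply.
apply: Ck_ext => // x Vx.
have dfh := df _ (hVU x Vx); have dhx := dh x Vx.
rewrite deriveE; last exact: differentiable_comp.
rewrite diff_comp // -[RHS]/('d f (h x) ('d h x v)).
rewrite [X in 'd f (h x) X]row_sum_delta linear_sum; apply: eq_bigr => j _.
rewrite linearZ /= (deriveE _ dfh).
suff -> : 'D_v (fun x => h x 0 j) x = 'd h x v 0 j by [].
pose c (N : 'rV[R]_n) : R := N 0 j.
have lc : linear c by move=> a M N; rewrite /c !mxE.
pose cM := GRing.isLinear.Build _ _ _ _ _ lc.
pose l : {linear 'rV[R]_n -> R} := HB.pack c cM.
have cl : continuous l by exact: coord_continuous.
have dl y : differentiable l y by exact: linear_differentiable.
have -> : (fun x => h x 0 j) = l \o h by [].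
rewrite deriveE; last exact: differentiable_comp.
rewrite diff_comp // -[LHS]/('d l (h x) ('d h x v)).
by rewrite (diff_lin _ cl).
Qed.

Lemma smooth_on_continuous m n (V : set 'rV[R]_m) (h : 'rV[R]_m -> 'rV[R]_n) x :
  smooth_on V h -> V x -> {for x, continuous h}.
Proof.
move=> hs Vx; apply: differentiable_continuous; apply: differentiable_rV => j.
exact: (hs 1%N j).1 x Vx.
Qed.

Lemma open_preimage_smooth m n (V : set 'rV[R]_m) (U : set 'rV[R]_n)
    (h : 'rV[R]_m -> 'rV[R]_n) :
  open V -> open U -> smooth_on V h -> open (V `&` h @^-1` U).
Proof.
move=> Vo Uo hs; rewrite openE => x [Vx Ux]; apply: filterI.
  exact: open_nbhs_nbhs.
by apply: (smooth_on_continuous hs Vx); exact: open_nbhs_nbhs.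
Qed.

Lemma smooth_on_comp m n p (U : set 'rV[R]_n) (V : set 'rV[R]_m)
    (f : 'rV[R]_n -> 'rV[R]_p) (h : 'rV[R]_m -> 'rV[R]_n) :
  open V -> smooth_on V h -> (forall x, V x -> U (h x)) ->
  smooth_on U f -> smooth_on V (f \o h).
Proof. by move=> Vo hs hVU fs k j; exact: Ck_comp hs hVU (fs k j). Qed.

Lemma Ck_local k n (U : set 'rV[R]_n) f :
  (forall x, U x -> exists V g,
    [/\ V x, open V, Ck k V g & forall y, V y -> f y = g y]) -> Ck k U f.
Proof.
elim: k f => [|k IH] f loc.
  move=> x /loc [V [g [Vx Vo Cg fg]]].
  by apply: (Ck_ext Vo _ Cg (k := 0%N)) => // y /fg.
split=> [x /loc [V [g [Vx Vo Cg fg]]]|v].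
  by have [+ _] := Ck_ext Vo (fun y Vy => esym (fg y Vy)) Cg; exact.
apply: IH => x /loc [V [g [Vx Vo Cg fg]]]; exists V, (fun x => 'D_v f x).
split=> //; have [_] := Ck_ext Vo (fun y Vy => esym (fg y Vy)) Cg; exact.
Qed.

End Calculus.

(* Smooth spaces. Every manifold, product, fibre product, total space of a *)
(* bundle and quotient below is handled inside diffeological spaces, where *)
(* subsets and quotients have canonical smooth structures. Manifolds with *)
(* their smooth maps are a full subcategory: a manifold carries the diffeology *)
(* whose plots are the smooth maps from open subsets of the R^n, and is a *)
(* diffeological space with smooth charts (is_manifold). On a fibre product *)
(* along a submersion, on a tensor product of U(1)-bundles and on a descended *)
(* bundle, the diffeology is the one of the usual manifold structure. *)

(* plot U f: f restricted to the open set U is a plot (values off U are junk) *)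
Record diffeology (R : realType) (T : Type) := Diffeology {
  plot : forall n, set 'rV[R]_n -> ('rV[R]_n -> T) -> Prop;
  plot_open : forall n (U : set 'rV[R]_n) f, plot U f -> open U;
  plot_cst : forall n (U : set 'rV[R]_n) x, open U -> plot U (fun=> x);
  plot_comp : forall m n (U : set 'rV[R]_n) (V : set 'rV[R]_m) f h,
    plot U f -> open V -> smooth_on V h -> (forall x, V x -> U (h x)) ->
    plot V (f \o h);
  plot_local : forall n (U : set 'rV[R]_n) f, open U ->
    (forall x, U x -> exists V g,
      [/\ V x, V `<=` U, plot V g & forall y, V y -> f y = g y]) ->
    plot U f
}.

Record dspace (R : realType) := DSpace {
  pt :> Type;
  space_diff : diffeology R pt
}.

Definition splot {R : realType} (X : dspace R) n (U : set 'rV[R]_n)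
  (f : 'rV[R]_n -> X) := plot (space_diff X) U f.

Section Spaces.
Context {R : realType}.
Implicit Types X Y : dspace R.

Definition smooth X Y (f : X -> Y) :=
  forall n (U : set 'rV[R]_n) p, splot U p -> splot U (f \o p).

Definition is_diffeo X Y (f : X -> Y) :=
  smooth f /\ exists2 g : Y -> X, smooth g & cancel f g /\ cancel g f.

(* the D-topology *)
Definition dopen X (A : set X) :=
  forall n (U : set 'rV[R]_n) p, splot U p -> open (U `&` p @^-1` A).

Program Definition prodS X Y : dspace R := @DSpace R (X * Y)%type
  (@Diffeology R _
    (fun n U f => splot U (fst \o f) /\ splot U (snd \o f)) _ _ _ _).
Next Obligation. by move=> X Y n U f [/plot_open]. Qed.
Next Obligation. by move=> X Y n U x Uo; split; exact: plot_cst. Qed.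
Next Obligation.
move=> X Y m n U V f h [f1 f2] Vo hs hVU.
by split; [exact: plot_comp f1 _ _ hVU|exact: plot_comp f2 _ _ hVU].
Qed.
Next Obligation.
move=> X Y n U f Uo loc; split; apply: plot_local => // x /loc.
  by case=> V [g [Vx VU [g1 _] fg]]; exists V, (fst \o g);
     split=> // y /fg /= ->.
by case=> V [g [Vx VU [_ g2] fg]]; exists V, (snd \o g); split=> // y /fg /= ->.
Qed.

Program Definition piS (I : Type) (X : I -> dspace R) : dspace R :=
  @DSpace R (forall i, X i)
  (@Diffeology R _ (fun n U f => open U /\
     forall i, splot U (fun x => f x i)) _ _ _ _).
Next Obligation. by move=> I X n U f []. Qed.
Next Obligation. by move=> I X n U x Uo; split=> // i; exact: plot_cst. Qed.
Next Obligation.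
move=> I X m n U V f h [Uo fp] Vo hs hVU; split=> // i.
exact: plot_comp (fp i) _ _ hVU.
Qed.
Next Obligation.
move=> I X n U f Uo loc; split=> // i; apply: plot_local => // x /loc.
case=> V [g [Vx VU [_ gp] fg]]; exists V, (fun x => g x i).
by split=> // [|y /fg -> //]; exact: gp.
Qed.

Program Definition subS X (A : set X) : dspace R := @DSpace R A
  (@Diffeology R _ (fun n U f => splot U (fun x => val (f x))) _ _ _ _).
Next Obligation. by move=> X A n U f /plot_open. Qed.
Next Obligation. by move=> X A n U x Uo; exact: plot_cst. Qed.
Next Obligation.
by move=> X A m n U V f h fp Vo hs hVU; exact: plot_comp fp _ _ hVU.
Qed.
Next Obligation.
move=> X A n U f Uo loc; apply: plot_local => // x /loc.
case=> V [g [Vx VU gp fg]]; exists V, (fun x => val (g x)).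
by split=> // y /fg ->.
Qed.

Definition mkS X (A : set X) (x : X) (h : A x) : subS A := SigSub (mem_set h).

Definition is_hausdorff X := forall x y : X, x <> y ->
  exists A B, [/\ dopen A, dopen B, A x, B y & A `&` B = set0].

(* phi is a diffeomorphism from the open set U onto a D-open subset *)
Definition is_chart X n (U : set 'rV[R]_n) (phi : 'rV[R]_n -> X) :=
  [/\ splot U phi,
      forall x y, U x -> U y -> phi x = phi y -> x = y,
      dopen (phi @` U) &
      forall m (V : set 'rV[R]_m) (g : 'rV[R]_m -> 'rV[R]_n),
        (forall x, V x -> U (g x)) -> splot V (phi \o g) -> smooth_on V g].

(* second countability is expressed by the countable atlas *)
Definition is_manifold X := is_hausdorff X /\
  exists n (C : set (set 'rV[R]_n * ('rV[R]_n -> X))),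
  [/\ countable C, forall c, C c -> is_chart c.1 c.2 &
      forall x, exists2 c, C c & (c.2 @` c.1) x].

(* in suitable charts phi, psi around x and f x, the local expression h of f *)
(* has a surjective differential *)
Definition is_submersion X Y (f : X -> Y) := smooth f /\
  forall x, exists m n (U : set 'rV[R]_m) (phi : 'rV[R]_m -> X)
    (V : set 'rV[R]_n) (psi : 'rV[R]_n -> Y) (u : 'rV[R]_m)
    (h : 'rV[R]_m -> 'rV[R]_n),
  [/\ is_chart U phi, U u /\ phi u = x, is_chart V psi,
      \forall a \near u, V (h a) /\ psi (h a) = f (phi a) &
      differentiable h u /\ forall w, exists v, 'd h u v = w].

Definition is_surj_submersion X Y (f : X -> Y) :=
  is_submersion f /\ forall y, exists x, f x = y.

(* The quotient by the equivalence relation generated by r; the plots of the *)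
(* quotient are the maps that lift locally to plots of X. *)
Section Quotient.
Variables (X : dspace R) (r : X -> X -> Prop).

Definition qclass (x : X) : set X := [set y | clos_refl_sym_trans X r x y].
Definition quot := set_type [set C | exists x, C = qclass x].
Definition cls (x : X) : quot := SigSub (mem_set (ex_intro _ x erefl)).

Lemma cls_surj (C : quot) : exists x, cls x = C.
Proof. by have [x Cx] := set_valP C; exists x; exact: val_inj. Qed.

Definition qrepr (C : quot) : X := projT1 (cid (cls_surj C)).

Lemma qreprK C : cls (qrepr C) = C.
Proof. by rewrite /qrepr; case: cid. Qed.

Lemma clsP x y : cls x = cls y <-> clos_refl_sym_trans X r x y.
Proof.
split=> [[]/(congr1 (@^~ y)) /=|xy].
  by rewrite /qclass /= => ->; exact: rst_refl.
apply: val_inj => /=; apply/seteqP; split=> z /=; last exact: rst_trans.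
by apply: rst_trans; exact: rst_sym.
Qed.

Lemma cls_eq x y : r x y -> cls x = cls y.
Proof. by move=> xy; apply/clsP; exact: rst_step. Qed.

Definition qlift (Z : Type) (f : X -> Z) (C : quot) : Z := f (qrepr C).

Lemma qliftE (Z : Type) (f : X -> Z) : (forall x y, r x y -> f x = f y) ->
  forall x, qlift f (cls x) = f x.
Proof.
move=> fr x; have fc a b : clos_refl_sym_trans X r a b -> f a = f b.
  by elim=> [? ? /fr||? ? _ ->|? ? ? _ -> _ ->].
by apply: fc; apply/clsP; exact: qreprK.
Qed.

Program Definition quotS : dspace R := @DSpace R quot
  (@Diffeology R _ (fun n U f => open U /\ forall x, U x -> exists V g,
     [/\ V x, V `<=` U, splot V g & forall y, V y -> f y = cls (g y)]) _ _ _ _).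
Next Obligation. by move=> n U f []. Qed.
Next Obligation.
move=> n U C Uo; split=> // x Ux; exists U, (fun=> qrepr C).
by split=> // [|y _]; [exact: plot_cst|rewrite qreprK].
Qed.
Next Obligation.
move=> m n U V f h [Uo loc] Vo hs hVU; split=> // x Vx.
have [W [g [Wx WU gp fg]]] := loc _ (hVU x Vx).
exists (V `&` h @^-1` W), (g \o h); split=> //; last by move=> y [_ /fg].
have VWo := open_preimage_smooth Vo (plot_open gp) hs.
apply: plot_comp gp VWo _ _; last by move=> y [].
by move=> k j; apply: CkS (hs k j) => y [].
Qed.
Next Obligation.
move=> n U f Uo loc; split=> // x /loc [V [g [Vx VU [Vo gl] fg]]].
have [W [k [Wx WV kp gk]]] := gl x Vx; exists W, k.
by split=> // [y /WV/VU|y Wy]; rewrite ?fg ?gk//; exact: WV.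
Qed.

End Quotient.

Program Definition complexS : dspace R := @DSpace R R[i]
  (@Diffeology R _ (fun n U f => open U /\ forall k,
    Ck k U (fun x => complex.Re (f x)) /\
    Ck k U (fun x => complex.Im (f x))) _ _ _ _).
Next Obligation. by move=> n U f []. Qed.
Next Obligation. by move=> n U x Uo; split=> // k; split; exact: Ck_cst. Qed.
Next Obligation.
move=> m n U V f h [Uo fs] Vo hs hVU; split=> // k; have [fr fi] := fs k.
by split; [exact: Ck_comp hs hVU fr|exact: Ck_comp hs hVU fi].
Qed.
Next Obligation.
move=> n U f Uo loc; split=> // k.
by split; apply: Ck_local => // x /loc [V [g [Vx VU [Vo /(_ k)[gr gi]] fg]]];
  [exists V, (fun x => complex.Re (g x))|exists V, (fun x => complex.Im (g x))];
  split=> // y /fg ->.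
Qed.

Definition circle : set complexS := [set z | `|z : R[i]| = 1].
Definition U1 : dspace R := subS circle.

Lemma u1_neq0 (z : U1) : (val z : R[i]) != 0.
Proof. by rewrite -normr_eq0 (set_valP z) oner_eq0. Qed.

Program Definition u1_one : U1 := @mkS _ circle (1 : R[i]) _.
Next Obligation. by rewrite /circle /= normr1. Qed.
Program Definition u1_mul (z w : U1) : U1 :=
  
  @mkS _ circle ((val z : R[i]) * (val w : R[i])) _.
Next Obligation.
by move=> z w; rewrite /circle /= normrM (set_valP z) (set_valP w) mulr1.
Qed.
Program Definition u1_inv (z : U1) : U1 := 
  @mkS _ circle (val z : R[i])^-1 _.
Next Obligation. by move=> z; rewrite /circle /= normfV (set_valP z) invr1. Qed.

Lemma u1_mulC : commutative u1_mul.
Proof. by move=> z w; apply: val_inj; rewrite /= mulrC. Qed.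
Lemma u1_mulA : associative u1_mul.
Proof. by move=> x y z; apply: val_inj; rewrite /= mulrA. Qed.
Lemma u1_mul1 : right_id u1_one u1_mul.
Proof. by move=> z; apply: val_inj; rewrite /= mulr1. Qed.
Lemma u1_inv1 : u1_inv u1_one = u1_one.
Proof. by apply: val_inj; rewrite /= invr1. Qed.
Lemma u1_invM z w : u1_inv (u1_mul z w) = u1_mul (u1_inv z) (u1_inv w).
Proof. by apply: val_inj; rewrite /= invfM. Qed.

End Spaces.

(* U(1)-bundles. u1_space is the bare fibrewise data; local triviality is *)
(* is_u1_bundle. The operations on bundles are defined on the data, and send *)
(* U(1)-bundles to U(1)-bundles. *)

Record u1_space (R : realType) (X : dspace R) := U1Space {
  tot :> dspace R;
  proj : tot -> X;
  act : tot -> U1 (R := R) -> tot;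
  proj_act : forall p z, proj (act p z) = proj p;
  act1 : forall p, act p u1_one = p;
  actM : forall p z w, act (act p z) w = act p (u1_mul z w)
}.

Record u1_section (R : realType) (X : dspace R) (P : u1_space X) := U1Section {
  sec :> X -> P;
  sec_smooth : smooth sec;
  sec_proj : forall x, proj (sec x) = x
}.

Section Bundles.
Context {R : realType}.
Implicit Types X Y : dspace R.

(* Principal U(1)-bundles. Local triviality makes the action free and *)
(* transitive on the fibres, and makes P a manifold when X is one. *)
Definition is_u1_bundle X (P : u1_space X) :=
  [/\ smooth (proj (u := P)),
      smooth (fun pz : prodS P U1 => act pz.1 pz.2) &
      forall x, exists A : set X, [/\ dopen A, A x &
        exists psi : prodS (subS A) U1 -> subS (proj (u := P) @^-1` A),
        [/\ is_diffeo psi,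
            forall a z, proj (val (psi (a, z))) = val a &
            forall a z w, val (psi (a, u1_mul z w)) = act (val (psi (a, z))) w]]].

(* bundle morphisms over the identity *)
Record u1_map X (P Q : u1_space X) := U1Map {
  u1_fun :> P -> Q;
  u1_fun_proj : forall p, proj (u1_fun p) = proj p;
  u1_fun_act : forall p z, u1_fun (act p z) = act (u1_fun p) z
}.

Definition is_u1_iso X (P Q : u1_space X) (f : u1_map P Q) := is_diffeo f.

Program Definition trivial X : u1_space X :=
  @U1Space R X (prodS X U1) fst (fun p z => (p.1, u1_mul p.2 z)) _ _ _.
Next Obligation. by []. Qed.
Next Obligation. by move=> X [x z] /=; rewrite u1_mul1. Qed.
Next Obligation. by move=> X [x z] w v /=; rewrite u1_mulA. Qed.

Section Pullback.
Variables (X Y : dspace R) (f : X -> Y) (Q : u1_space Y).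

Definition pull_set : set (prodS X Q) := [set xq | f xq.1 = proj xq.2].

Definition pull_elt x (q : Q) (h : f x = proj q) : subS pull_set :=
  @mkS _ _ pull_set (x, q) h.

Lemma pull_act_subproof (p : subS pull_set) z :
  f (val p).1 = proj (act (val p).2 z).
Proof. by rewrite proj_act; exact: set_valP p. Qed.

Program Definition pullback : u1_space X :=
  @U1Space R X (subS pull_set) (fun p => (val p).1)
    (fun p z => pull_elt (pull_act_subproof p z)) _ _ _.
Next Obligation. by []. Qed.
Next Obligation. by move=> p; apply: val_inj; rewrite /= act1 -surjective_pairing. Qed.
Next Obligation. by move=> p z w; apply: val_inj; rewrite /= actM. Qed.

End Pullback.

(* Q if b = false, the dual Q^* (Q with the inverse action) if b = true *)
Program Definition tpow X (b : bool) (Q : u1_space X) : u1_space X :=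
  @U1Space R X Q (proj (u := Q))
    (fun q z => act q (if b then u1_inv z else z)) _ _ _.
Next Obligation. by move=> X b Q q z; exact: proj_act. Qed.
Next Obligation. by move=> X [] Q q; rewrite ?u1_inv1 act1. Qed.
Next Obligation. by move=> X [] Q q z w; rewrite actM ?u1_invM. Qed.

(* Q_0 (x) ... (x) Q_n: the fibre product of the Q_i modulo the tuples z in *)
(* U(1)^(n+1) with product 1 *)
Section Tensor.
Variables (X : dspace R) (n : nat) (Q : 'I_n.+1 -> u1_space X).

Definition tens_set : set (prodS X (piS (fun i => Q i))) :=
  [set xq | forall i, proj (xq.2 i) = xq.1].

Definition tens_rel (a b : subS tens_set) :=
  exists z : 'I_n.+1 -> U1 (R := R),
    [/\ \prod_i (val (z i) : R[i]) = 1, (val b).1 = (val a).1 &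
        forall i, (val b).2 i = act ((val a).2 i) (z i)].

Definition tens_pre x (q : forall i, Q i) (h : forall i, proj (q i) = x) :
  subS tens_set := @mkS _ _ tens_set (x, q) h.

Lemma tens_act_subproof (a : subS tens_set) (z : U1 (R := R)) i :
  proj (if i == ord0 then act ((val a).2 i) z else (val a).2 i) = (val a).1.
Proof. by case: eqP => _; rewrite ?proj_act; exact: (set_valP a). Qed.

Definition tens_pre_act a z := tens_pre (tens_act_subproof a z).

Lemma tens_rel_act a b z :
  tens_rel a b -> tens_rel (tens_pre_act a z) (tens_pre_act b z).
Proof.
move=> [w [w1 ab1 ab2]]; exists w; split=> //= i.
by rewrite ab2; case: eqP => // _; rewrite !actM u1_mulC.
Qed.

Definition tens_proj := @qlift _ _ tens_rel X (fun a => (val a).1).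

Definition tens_act C z :=
  @qlift _ _ tens_rel _ (fun a => cls tens_rel (tens_pre_act a z)) C.

Lemma tens_projE a : tens_proj (cls tens_rel a) = (val a).1.
Proof. by apply: qliftE => x y [w []]. Qed.

Lemma tens_actE a z :
  tens_act (cls tens_rel a) z = cls tens_rel (tens_pre_act a z).
Proof. by apply: qliftE => x y /(@tens_rel_act _ _ z)/cls_eq. Qed.

Program Definition tensor : u1_space X :=
  @U1Space R X (quotS tens_rel) tens_proj tens_act _ _ _.
Next Obligation.
by move=> C z; have [a <-] := cls_surj C; rewrite tens_actE !tens_projE.
Qed.
Next Obligation.
move=> C; have [a <-] := cls_surj C; rewrite tens_actE.
congr cls; apply: val_inj; rewrite /= [RHS]surjective_pairing; congr pair.
by apply: functional_extensionality_dep => i; case: eqP => // _; rewrite act1.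
Qed.
Next Obligation.
move=> C z w; have [a <-] := cls_surj C; rewrite !tens_actE.
congr cls; apply: val_inj; rewrite /=; congr pair.
by apply: functional_extensionality_dep => i; case: eqP => // _; rewrite actM.
Qed.

(* q_0 (x) ... (x) q_n *)
Definition tens_elt x (q : forall i, Q i) (h : forall i, proj (q i) = x) :
  tensor := cls tens_rel (tens_pre h).

Lemma proj_tens_elt x (q : forall i, Q i) (h : forall i, proj (q i) = x) :
  proj (tens_elt h) = x.
Proof. exact: tens_projE. Qed.

End Tensor.

(* f_0^{-1}(Q) (x) f_1^{-1}(Q)^* (x) f_2^{-1}(Q) (x) ... *)
Definition alt_tensor X' X n (f : 'I_n.+1 -> X' -> X) (Q : u1_space X) :=
  tensor (fun i => tpow (odd i) (pullback (f i) Q)).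

Definition alt_elt X' X n (f : 'I_n.+1 -> X' -> X) (Q : u1_space X) x
    (q : 'I_n.+1 -> Q) (h : forall i, f i x = proj (q i)) : alt_tensor f Q :=
  @tens_elt X' n (fun i => tpow (odd i) (pullback (f i) Q)) x
    (fun i => pull_elt (h i)) (fun=> erefl).

Lemma proj_alt_elt X' X n (f : 'I_n.+1 -> X' -> X) (Q : u1_space X) x
    (q : 'I_n.+1 -> Q) (h : forall i, f i x = proj (q i)) :
  proj (alt_elt h) = x.
Proof. exact: proj_tens_elt. Qed.

Lemma alt_elt_eq X' X n (f : 'I_n.+1 -> X' -> X) (Q : u1_space X) x
    (q q' : 'I_n.+1 -> Q) (h : forall i, f i x = proj (q i))
    (h' : forall i, f i x = proj (q' i)) :
  (forall i, q i = q' i) -> alt_elt h = alt_elt h'.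
Proof.
move=> /funext qq'; subst q'.
by congr (alt_elt _); exact: Prop_irrelevance.
Qed.

Lemma alt_elt_act_subproof X' X n (f : 'I_n.+1 -> X' -> X) (Q : u1_space X) x
    (q : 'I_n.+1 -> Q) (z : U1 (R := R)) (h : forall i, f i x = proj (q i)) i :
  f i x = proj (if i == ord0 then act (q i) z else q i).
Proof. by case: eqP; rewrite ?proj_act. Qed.

Lemma alt_elt_act X' X n (f : 'I_n.+1 -> X' -> X) (Q : u1_space X) x
    (q : 'I_n.+1 -> Q) (h : forall i, f i x = proj (q i)) z :
  act (alt_elt h) z = alt_elt (alt_elt_act_subproof z h).
Proof.
rewrite [LHS]tens_actE; congr cls; apply: val_inj; rewrite /=; congr pair.
apply: functional_extensionality_dep => i; apply: val_inj => /=.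
by case: eqP => [->|_].
Qed.

(* Descent of a bundle B over Y along f : Y -> X, by identifying the elements *)
(* of B that correspond under r *)
Section Descent.
Variables (Y X : dspace R) (f : Y -> X) (B : u1_space Y) (r : B -> B -> Prop).
Hypothesis rproj : forall a b, r a b -> f (proj a) = f (proj b).
Hypothesis ract : forall a b z, r a b -> r (act a z) (act b z).

Definition desc_proj := @qlift _ _ r X (fun a => f (proj a)).

Definition desc_act C z := @qlift _ _ r _ (fun a => cls r (act a z)) C.

Lemma desc_projE a : desc_proj (cls r a) = f (proj a).
Proof. by apply: qliftE => x y /rproj. Qed.

Lemma desc_actE a z : desc_act (cls r a) z = cls r (act a z).
Proof. by apply: qliftE => x y /(ract z)/cls_eq. Qed.

Program Definition descent : u1_space X :=
  @U1Space R X (quotS r) desc_proj desc_act _ _ _.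
Next Obligation.
move=> C z; have [a <-] := cls_surj C.
by rewrite desc_actE !desc_projE proj_act.
Qed.
Next Obligation.
by move=> C; have [a <-] := cls_surj C; rewrite desc_actE act1.
Qed.
Next Obligation.
by move=> C z w; have [a <-] := cls_surj C; rewrite !desc_actE actM.
Qed.

End Descent.

End Bundles.

Record simp_space (R : realType) := SimpSpace {
  level :> nat -> dspace R;
  face : forall n, 'I_n.+2 -> level n.+1 -> level n;
  degen : forall n, 'I_n.+1 -> level n -> level n.+1
}.

Definition inj_up n (i : 'I_n) : 'I_n.+1 := widen_ord (leqnSn n) i.
Definition shift_up n (i : 'I_n) : 'I_n.+1 := lift ord0 i.

Record simp_map (R : realType) (Y X : simp_space R) := SimpMap {
  smap :> forall n, Y n -> X n;
  smap_face : forall n (i : 'I_n.+2) y, smap (face i y) = face i (smap y);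
  smap_degen : forall n (i : 'I_n.+1) y, smap (degen i y) = degen i (smap y)
}.

Section Simplicial.
Context {R : realType}.
Implicit Types X Y : simp_space R.

Definition is_simplicial_manifold X :=
  [/\ forall n, is_manifold (X n),
      (forall n i, smooth (face (s := X) (n := n) i)) /\
      (forall n i, smooth (degen (s := X) (n := n) i)),
      forall n (i j : 'I_n.+2) (x : X n.+2), (i <= j)%N ->
        face i (face (shift_up j) x) = face j (face (inj_up i) x),
      forall n (i j : 'I_n.+1) (x : X n), (i <= j)%N ->
        degen (inj_up i) (degen j x) = degen (shift_up j) (degen i x) &
      [/\ forall n (i : 'I_n.+2) (j : 'I_n.+1) (x : X n.+1), (i <= j)%N ->
            face (inj_up i) (degen (shift_up j) x) = degen j (face i x),
          forall n (i : 'I_n.+1) (x : X n), face (inj_up i) (degen i x) = x,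
          forall n (i : 'I_n.+1) (x : X n), face (shift_up i) (degen i x) = x &
          forall n (i : 'I_n.+2) (j : 'I_n.+1) (x : X n.+1), (j < i)%N ->
            face (shift_up i) (degen (inj_up j) x) = degen j (face i x)]].

Definition is_simp_surj_submersion Y X (f : simp_map Y X) :=
  forall n, is_surj_submersion (f n).

Definition delta X p (Q : u1_space (X p)) : u1_space (X p.+1) :=
  alt_tensor (face (s := X) (n := p)) Q.

Definition delta_sec X p (Q : u1_space (X p)) (s : u1_section Q) (x : X p.+1) :
    delta Q :=
  alt_elt (x := x) (q := fun i => s (face i x))
    (fun i => esym (sec_proj s (face i x))).

(* Over x in X_(p+2), delta^2(Q) is the alternating tensor product of the *)
(* fibres of Q at the d_j d_i x. The simplicial identity *)
(* d_i d_(j+1) = d_j d_i (i <= j) pairs the factors (j + 1, i) and (i, j), *)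
(* which have opposite signs. The canonical section 1 is obtained by taking *)
(* the same element in paired factors; u i below is the (i)-th tensor factor. *)
Definition unit_factors X p (Q : u1_space (X p)) (x : X p.+2)
    (u : 'I_p.+3 -> delta Q) :=
  exists (t : 'I_p.+3 -> 'I_p.+2 -> Q)
         (h : forall i j, face j (face i x) = proj (t i j)),
    (forall i j : 'I_p.+2, (i <= j)%N -> t (shift_up j) i = t (inj_up i) j) /\
    (forall i, u i = alt_elt (h i)).

Definition is_unit_delta2 X p (Q : u1_space (X p)) (v : delta (delta Q)) :=
  exists x u (h : forall i, face i x = proj (u i)),
    unit_factors x u /\ v = alt_elt h.

End Simplicial.

Section FibreSquare.
Context {R : realType}.

Definition sq_set (M Y : dspace R) (pi : Y -> M) : set (prodS Y Y) :=
  [set y | pi y.1 = pi y.2].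

(* Y^[2] *)
Definition sq (M Y : dspace R) (pi : Y -> M) : dspace R := subS (sq_set pi).

Variables (Y X : simp_space R) (pi : simp_map Y X).

Lemma sq_face_subproof n (i : 'I_n.+2) (y : sq (pi n.+1)) :
  sq_set (pi n) (face i (val y).1, face i (val y).2).
Proof. by rewrite /sq_set /= !smap_face; congr face; exact: set_valP y. Qed.

Lemma sq_degen_subproof n (i : 'I_n.+1) (y : sq (pi n)) :
  sq_set (pi n.+1) (degen i (val y).1, degen i (val y).2).
Proof. by rewrite /sq_set /= !smap_degen; congr degen; exact: set_valP y. Qed.

Definition sq_simp : simp_space R :=
  @SimpSpace R (fun n => sq (pi n))
    (fun n i y => mkS (sq_face_subproof i y))
    (fun n i y => mkS (sq_degen_subproof i y)).

End FibreSquare.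

(* A U(1)-bundle P over Y^[2] with a product; gmul a b is defined for a over *)
(* (y1, y2) and b over (y2, y3). By bilinearity (is_bundle_gerbe), it is a *)
(* map on the tensor product of the two fibres. *)
Definition composable (R : realType) (M Y : dspace R) (pi : Y -> M)
  (P : u1_space (sq pi)) (a b : P) := (val (proj a)).2 = (val (proj b)).1.

Record gerbe (R : realType) (M Y : dspace R) (pi : Y -> M) := Gerbe {
  gbun : u1_space (sq pi);
  gmul : forall a b : gbun, composable a b -> gbun
}.

Section Gerbe.
Context {R : realType}.

Definition is_bundle_gerbe (M Y : dspace R) (pi : Y -> M) (Gb : gerbe pi) :=
  let P := gbun Gb in
  let comp : set (prodS P P) := [set ab | composable ab.1 ab.2] in
  [/\ [/\ is_manifold M, is_manifold Y, is_surj_submersion pi & is_u1_bundle P],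
      smooth (fun ab : subS comp => gmul (set_valP ab) : P),
      forall (a b : P) (h : composable a b), val (proj (gmul h)) =
        ((val (proj a)).1, (val (proj b)).2),
      forall (a b : P) z (h : composable a b) (hl : composable (act a z) b)
        (hr : composable a (act b z)),
        gmul hl = act (gmul h) z /\ gmul hr = act (gmul h) z &
      forall (a b c : P) (hab : composable a b) (hbc : composable b c)
        (hl : composable (gmul hab) c) (hr : composable a (gmul hbc)),
        gmul hl = gmul hr].

Section Trivialisation.
Variables (M Y : dspace R) (pi : Y -> M) (T : u1_space Y).

(* delta_Y(T) at (y_1, y_2) is T_(y_2) (x) T_(y_1)^* *)
Definition deltaY : u1_space (sq pi) :=
  alt_tensor (fun (i : 'I_2) (y : sq pi) =>
    if i == ord0 then (val y).2 else (val y).1) T.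

Definition sq_elt (t1 t2 : T) (h : pi (proj t1) = pi (proj t2)) : sq pi :=
  @mkS _ _ (sq_set pi) (proj t1, proj t2) h.

Lemma deltaY_subproof (t2 t1 : T) (h : pi (proj t1) = pi (proj t2)) (i : 'I_2) :
  (if i == ord0 then (val (sq_elt h)).2 else (val (sq_elt h)).1) =
  proj (if i == ord0 then t2 else t1).
Proof. by case: eqP. Qed.

(* t2 (x) t1^* *)
Definition deltaY_elt (t2 t1 : T) (h : pi (proj t1) = pi (proj t2)) : deltaY :=
  alt_elt (deltaY_subproof h).

Lemma deltaY_elt_act (t2 t1 : T) z (h : pi (proj t1) = pi (proj t2))
    (h' : pi (proj (act t1 z)) = pi (proj (act t2 z))) :
  deltaY_elt h' = deltaY_elt h.
Proof.
apply/esym/cls_eq.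
exists (fun i : 'I_2 => if i == ord0 then z else u1_inv z); split.
- by rewrite !big_ord_recl big_ord0 /= mulr1 mulfV // u1_neq0.
- by apply: val_inj; rewrite /= !proj_act.
- move=> i; apply: val_inj => /=; congr pair.
    by apply: val_inj; rewrite /= !proj_act.
  case: i => [[|[|//]] ilt] //=.
  by congr act; apply: val_inj; rewrite /= invrK.
Qed.

(* prod a b c: the product of a and b is c *)
Definition is_trivialisation (P : u1_space (sq pi)) (prod : P -> P -> P -> Prop)
    (phi : u1_map deltaY P) :=
  [/\ is_u1_bundle T, is_u1_iso phi &
      forall (t1 t2 t3 : T) (h12 : pi (proj t1) = pi (proj t2))
        (h23 : pi (proj t2) = pi (proj t3)) (h13 : pi (proj t1) = pi (proj t3)),
        prod (phi (deltaY_elt h12)) (phi (deltaY_elt h23))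
             (phi (deltaY_elt h13))].

End Trivialisation.

Section Extension.
Variables (Y X : simp_space R) (pi : simp_map Y X) (Gb : gerbe (pi 0%N)).

Definition delta_gbun : u1_space (sq (pi 1%N)) :=
  delta (X := sq_simp pi) (p := 0%N) (gbun Gb).

(* the product of delta(P): (a_0 (x) a_1^* ) (b_0 (x) b_1^* ) = *)
(* a_0 b_0 (x) (a_1 b_1)^* *)
Definition delta_mul (u v w : delta_gbun) :=
  exists (y z x : sq_simp pi 1%N) (a b : 'I_2 -> gbun Gb)
    (ha : forall i, face i y = proj (a i))
    (hb : forall i, face i z = proj (b i))
    (hab : forall i, composable (a i) (b i))
    (hx : forall i, face i x = proj (gmul (hab i))),
  [/\ (val y).2 = (val z).1, val x = ((val y).1, (val z).2),
      u = alt_elt ha, v = alt_elt hb & w = alt_elt hx].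

Variables (T : u1_space (Y 1%N)) (phi : u1_map (deltaY (pi 1%N) T) delta_gbun).

Definition is_delta_trivialisation := is_trivialisation delta_mul phi.

(* The descent identification on delta(T) -> Y_2: for w1, w2 over the same *)
(* point of X_2, a in delta(T)_(w1) and b in delta(T)_(w2) are identified when *)
(* delta(phi) sends b (x) a^* to the canonical element 1 of delta^2(P). *)
Definition desc_rel (a b : delta (X := Y) T) :=
  exists (w1 w2 : Y 2%N) (hw : pi 2%N w1 = pi 2%N w2) (t1 t2 : 'I_3 -> T)
    (h1 : forall i, face i w1 = proj (t1 i))
    (h2 : forall i, face i w2 = proj (t2 i))
    (h12 : forall i, pi 1%N (proj (t1 i)) = pi 1%N (proj (t2 i)))
    (hd : forall i, face i (mkS (A := sq_set (pi 2%N)) (x := (w1, w2)) hw :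
                       sq_simp pi 2%N) = proj (phi (deltaY_elt (h12 i)))),
  [/\ a = alt_elt h1, b = alt_elt h2 &
      is_unit_delta2 (X := sq_simp pi) (p := 0%N) (Q := gbun Gb) (alt_elt hd)].

Lemma desc_rel_proj a b : desc_rel a b -> pi 2%N (proj a) = pi 2%N (proj b).
Proof.
by move=> [w1 [w2 [hw [t1 [t2 [h1 [h2 [h12 [hd [-> -> _]]]]]]]]]];
   rewrite !proj_alt_elt.
Qed.

Lemma desc_rel_act a b z : desc_rel a b -> desc_rel (act a z) (act b z).
Proof.
move=> [w1 [w2 [hw [t1 [t2 [h1 [h2 [h12 [hd [-> -> ud]]]]]]]]]].
rewrite !alt_elt_act.
pose s (t : 'I_3 -> T) i := if i == ord0 then act (t i) z else t i.
have h12' i : pi 1%N (proj (s t1 i)) = pi 1%N (proj (s t2 i)).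
  by rewrite /s; case: eqP => _; rewrite ?proj_act.
have E i : deltaY_elt (h12' i) = deltaY_elt (h12 i).
  move: (h12' i); rewrite /s; case: eqP => _ h'; first exact: deltaY_elt_act.
  by congr deltaY_elt; exact: Prop_irrelevance.
exists w1, w2, hw, (s t1), (s t2), (alt_elt_act_subproof z h1).
exists (alt_elt_act_subproof z h2), h12'.
have hd' i : face i (mkS (A := sq_set (pi 2%N)) (x := (w1, w2)) hw :
    sq_simp pi 2%N) = proj (phi (deltaY_elt (h12' i))) by rewrite E; exact: hd.
exists hd'; split=> //.
by rewrite (alt_elt_eq hd' hd) // => i; rewrite E.
Qed.

(* the bundle A_T -> X_2 to which delta(T) -> Y_2 descends *)
Definition A_T : u1_space (X 2%N) := descent desc_rel_proj desc_rel_act.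

Definition A_T_class (a : delta (X := Y) T) : A_T := cls desc_rel a.

(* the element 1 of delta(A_T) at x, image of the canonical element of *)
(* delta^2(T) at any w over x *)
Definition is_unit_delta_A (x : X 3%N) (v : delta (X := X) A_T) :=
  exists (w : Y 3%N) (u : 'I_4 -> delta (X := Y) T)
    (h : forall i, face i x = proj (A_T_class (u i))),
    [/\ pi 3%N w = x, unit_factors w u & v = alt_elt h].

(* (Y, T, s) is a simplicial extension of Gb over X. That Y extends *)
(* Y_0 -> X_0 is part of the typing: Gb is a gerbe for pi_0 : Y_0 -> X_0. *)
Definition is_simplicial_extension (s : u1_section A_T) :=
  [/\ is_simplicial_manifold X /\ is_simplicial_manifold Y,
      is_simp_surj_submersion pi,
      is_bundle_gerbe Gb,
      is_delta_trivialisation &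
      forall x : X 3%N, is_unit_delta_A x (delta_sec s x)].

End Extension.
End Gerbe.

Section Group.
Context {R : realType} (G : groupType) (DG : diffeology R G).

Definition groupS : dspace R := DSpace DG.

Definition is_lie_group :=
  [/\ is_manifold groupS,
      smooth (fun gh : prodS groupS groupS => (gh.1 * gh.2)%g : groupS) &
      smooth (fun g : groupS => (g^-1)%g : groupS)].

(* smooth right actions *)
Definition is_smooth_action (X : dspace R) (a : X -> G -> X) :=
  [/\ smooth (fun xg : prodS X groupS => a xg.1 xg.2),
      forall x, a x 1%g = x &
      forall x g h, a x (g * h)%g = a (a x g) h].

Section EG.
Variables (X : dspace R) (a : X -> G -> X).

(* (x, g_1, ..., g_n) is represented by the iterated pair (((x, g_1), ...), g_n) *)
Fixpoint EG_level (n : nat) : dspace R :=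
  if n is n'.+1 then prodS (EG_level n') groupS else X.

Fixpoint EG_face (n i : nat) : EG_level n.+1 -> EG_level n :=
  match n with
  | 0 => fun w => if i == 0%N then a w.1 w.2 else w.1
  | n'.+1 => fun w =>
      if i == n'.+2 then w.1
      else if i == n'.+1 then (w.1.1, (w.1.2 * w.2)%g)
      else (EG_face i w.1, w.2)
  end.

(* s_i inserts 1 after g_i *)
Fixpoint EG_degen (n i : nat) : EG_level n -> EG_level n.+1 :=
  match n with
  | 0 => fun w => (w, 1%g)
  | n'.+1 => fun w =>
      if i == n'.+1 then (w, 1%g) else (EG_degen i w.1, w.2)
  end.

Definition EG : simp_space R :=
  @SimpSpace R EG_level (fun n i => @EG_face n i) (fun n i => @EG_degen n i).

End EG.

Section EGmap.
Variables (Y M : dspace R) (aY : Y -> G -> Y) (aM : M -> G -> M) (pi : Y -> M).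
Hypothesis pi_equiv : forall y g, pi (aY y g) = aM (pi y) g.

Fixpoint EG_fun (n : nat) : EG_level Y n -> EG_level M n :=
  match n with
  | 0 => pi
  | n'.+1 => fun w => (EG_fun w.1, w.2)
  end.

Lemma EG_fun_face n (i : 'I_n.+2) (w : EG aY n.+1) :
  EG_fun (face i w : EG aY n) = face i (EG_fun w : EG aM n.+1).
Proof.
case: i => i ilt /=; clear ilt.
elim: n w => [|n IH] w /=; first by case: eqP.
by case: eqP => // _; case: eqP => //= _; rewrite IH.
Qed.

Lemma EG_fun_degen n (i : 'I_n.+1) (w : EG aY n) :
  EG_fun (degen i w : EG aY n.+1) = degen i (EG_fun w : EG aM n).
Proof.
case: i => i ilt /=; clear ilt.
elim: n w => [|n IH] w //=.
by case: eqP => //= _; congr pair; exact: IH.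
Qed.

Definition EG_map : simp_map (EG aY) (EG aM) :=
  @SimpMap R (EG aY) (EG aM) EG_fun EG_fun_face EG_fun_degen.

End EGmap.

Section Strong.
Variables (M Y : dspace R) (pi : Y -> M) (aM : M -> G -> M) (Gb : gerbe pi).

Record strong_action := StrongAction {
  sa_Y : Y -> G -> Y;
  sa_Y_action : is_smooth_action sa_Y;
  sa_equiv : forall y g, pi (sa_Y y g) = aM (pi y) g;
  sa_P : gbun Gb -> G -> gbun Gb;
  sa_P_action : is_smooth_action sa_P;
  sa_P_proj : forall p g, val (proj (sa_P p g)) =
    (sa_Y (val (proj p)).1 g, sa_Y (val (proj p)).2 g);
  sa_P_act : forall p z g, sa_P (act p z) g = act (sa_P p g) z;
  sa_P_mul : forall (p q : gbun Gb) g (h : composable p q)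
    (h' : composable (sa_P p g) (sa_P q g)), gmul h' = sa_P (gmul h) g
}.

(* A weak action of G on a gerbe: a simplicial extension over EG(M). *)
Definition is_weak_action (Yb : simp_space R) (f : simp_map Yb (EG aM))
    (Gb0 : gerbe (f 0%N)) (T : u1_space (Yb 1%N))
    (phi : u1_map (deltaY (f 1%N) T) (delta_gbun Gb0)) :=
  is_simplicial_extension (phi := phi).

Section Induced.
Variable S : strong_action.

Definition ind_Y : simp_space R := EG (sa_Y S).
Definition ind_pi : simp_map ind_Y (EG aM) := EG_map (sa_equiv S).
Definition ind_gerbe : gerbe (ind_pi 0%N) := Gb.
Definition ind_T : u1_space (ind_Y 1%N) := trivial (ind_Y 1%N).

(* The isomorphism P_(y1,y2)^* (x) P_(y1 g,y2 g) -> U(1) given by g^-1 sends *)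
(* p^* (x) q, with q g^-1 = p u, to u; its inverse sends 1 to p^* (x) p g for *)
(* any p in P_(y1,y2). phi is this inverse on *)
(* (ind_T)_(y2,g) (x) (ind_T)_(y1,g)^* = U(1): it sends 1 (x) 1^* to *)
(* p g (x) p^*, which determines phi since phi commutes with U(1). *)
Definition is_ind_iso
    (phi : u1_map (deltaY (ind_pi 1%N) ind_T) (delta_gbun ind_gerbe)) :=
  forall (p : gbun Gb) (g : G),
  let t (y : Y) : ind_T := ((y, g), u1_one) in
  let y := val (proj p) in
  exists (ht : ind_pi 1%N (proj (t y.1)) = ind_pi 1%N (proj (t y.2)))
    (yg : sq_simp ind_pi 1%N)
    (hq : forall i : 'I_2, face i yg =
      proj (if i == ord0 then sa_P S p g else p)),
  val yg = ((y.1, g), (y.2, g)) /\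
  phi (deltaY_elt ht) = alt_elt hq.

(* s is the section of A_T whose value at the image of w is the class of *)
(* 1 (x) 1^* (x) 1 in delta(ind_T)_w *)
Definition is_ind_section
    (phi : u1_map (deltaY (ind_pi 1%N) ind_T) (delta_gbun ind_gerbe))
    (s : u1_section (A_T phi)) :=
  forall w : ind_Y 2%N,
  s (ind_pi 2%N w) = A_T_class phi
    (alt_elt (x := w) (q := fun i => (face i w, u1_one) : ind_T) (fun=> erefl)).

End Induced.
End Strong.
End Group.

(* Main.v *)
(** Over ((y1, g), (y2, g)) in EG(Y)_1^[2], the element [p g (x) p^*] of
[delta(P)] does not depend on the choice of [p] in [P_(y1, y2)]. It is a global
section of [delta(P)], which turns the trivial bundle into a trivialisation: it is smooth
because [P] has local sections, and multiplicative because G acts by gerbe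
morphisms. The trivialisation of [delta^2(P)] it induces over
((y1, g, h), (y2, g, h)) is the canonical section: its six factors pg.h, pg,
p.gh, p, pg, p agree in pairs. Hence 1 (x) 1^* (x) 1 descends to [A_T].
Smoothness of the descended section needs local smooth sections of the
submersion EG(Y)_2 -> EG(M)_2, which come from the inverse function theorem. *)
From HB Require Import structures.
From mathcomp Require Import all_boot all_order all_algebra complex.
From mathcomp Require Import all_classical all_reals topology normedtype.
From mathcomp Require Import landau derive sequences.
From mathcomp Require Import interval_inference ring lra.
Require Import Defs.
Set Implicit Arguments.
Unset Strict Implicit.
Unset Printing Implicit Defensive.
Import Order.TTheory GRing.Theory Num.Theory.
Import numFieldNormedType.Exports.
Local Open Scope classical_set_scope.

(** * Smooth maps between open subsets of R^n *)

Section SmoothFunctions.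
Context {R : realType}.
Local Open Scope ring_scope.

(** Tensor products and [A_T] are quotients, so smoothness of maps out of them is tested by lifting
    plots locally; [subduction] isolates this property and [smooth_desc] uses it. The isomorphism
    [phi] is obtained without local trivialisations of [deltaY] or [delta_gbun]: a global section
    together with a homogeneous U(1)-valued coordinate separating the points of each fibre
    ([is_frame]) identifies a bundle with the trivial one, and the frames of the two bundles are
    matched. On [delta_gbun] the coordinate is the isomorphism with U(1) by which the induced action
    is defined. A submersion is given by charts in which the differential is onto at one point only.
    Lifting plots along it takes smooth local sections, hence an inverse function theorem that
    includes smoothness of the inverse. *)

Lemma le_coord n (v : 'rV[R]_n) j : `|v 0 j| <= `|v|.
Proof.
by rewrite [leRHS]/Num.norm /= mx_normrE; apply/bigmax_geP; right => /=; exists (0, j).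
Qed.

Lemma norm_rV_le n (v : 'rV[R]_n) c :
  0 <= c -> (forall j, `|v 0 j| <= c) -> `|v| <= c.
Proof.
move=> c0 vc; rewrite [leLHS]/Num.norm /= mx_normrE; apply/bigmax_leP; split=> // i _.
by rewrite (ord1 i.1).
Qed.

Lemma mulmx_coord_continuous m n (L : 'M[R]_(m, n)) :
  continuous (fun v : 'rV[R]_m => v *m L).
Proof.
move=> x; apply: differentiable_continuous; apply: differentiable_rV => j.
have -> : (fun v : 'rV[R]_m => (v *m L) 0 j) = \sum_i (fun v : 'rV[R]_m => L i j *: v 0 i).
  by apply/funext => v; rewrite fct_sumE mxE; apply: eq_bigr => i _; rewrite mulrC.
apply: differentiable_sum => i; apply: differentiableZ; exact: differentiable_coord.
Qed.

(** Serves where the differential must be guessed, as for an inverse function: uniqueness of the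
    differential identifies it with the guess. *)
Lemma differentiableP_eps (V W : normedModType R) (f : V -> W) x (l : {linear V -> W}) :
  continuous l ->
  (forall e, 0 < e -> \forall d \near (0 : V), `|f (d + x) - f x - l d| <= e * `|d|) ->
  differentiable f x /\ 'd f x = l :> (V -> W).
Proof.
move=> cl H; have E : f \o shift x = cst (f x) + l +o_ (0 : V) id.
  apply/eqaddoP => e /H; apply: filterS => d /=.
  by rewrite !fctE opprD addrA.
have D := diff_unique cl E.
split=> //; apply/diff_locallyP; rewrite D; split=> //.
Qed.

Lemma differentiable_eps (V W : normedModType R) (f : V -> W) x : differentiable f x ->
  forall e, 0 < e -> \forall d \near (0 : V), `|f (d + x) - f x - 'd f x d| <= e * `|d|.
Proof.
move=> /diff_locallyP[_ /eqaddoP H] e /H; apply: filterS => d.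
by rewrite !fctE /= opprD addrA.
Qed.

Lemma diff_coord m n (h : 'rV[R]_m -> 'rV[R]_n) x j v :
  (forall j, differentiable (fun x => h x 0 j) x) ->
  'd h x v 0 j = 'D_v (fun x => h x 0 j) x.
Proof.
move=> dh; have dhx := differentiable_rV dh.
pose c (N : 'rV[R]_n) : R := N 0 j.
have lc : linear c by move=> a M N; rewrite /c !mxE.
pose cM := GRing.isLinear.Build _ _ _ _ _ lc.
pose l : {linear 'rV[R]_n -> R} := HB.pack c cM.
have cl : continuous l by exact: coord_continuous.
have dl y : differentiable l y by exact: linear_differentiable.
have -> : (fun x => h x 0 j) = l \o h by [].
rewrite deriveE; last exact: differentiable_comp.
by rewrite (diff_comp dhx (dl (h x))) -[RHS]/('d l (h x) ('d h x v)) (diff_lin _ cl).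
Qed.

(** Points are row vectors, so this is the transpose of the usual Jacobian matrix: the differential
    is right multiplication by it ([diff_jac]). *)
Definition jac m n (h : 'rV[R]_m -> 'rV[R]_n) x : 'M[R]_(m, n) :=
  \matrix_(i, j) 'D_(delta_mx 0 i) (fun x => h x 0 j) x.

Lemma diff_jac m n (h : 'rV[R]_m -> 'rV[R]_n) x v :
  (forall j, differentiable (fun x => h x 0 j) x) -> 'd h x v = v *m jac h x.
Proof.
move=> dh; apply/rowP => j; rewrite {1}(row_sum_delta v) linear_sum summxE mxE.
by apply: eq_bigr => i _; rewrite linearZ /= !mxE diff_coord.
Qed.

Lemma Ck_coord k n (U : set 'rV[R]_n) j : Ck k U (fun x => x 0 j).
Proof.
case: k => [|k] /=; first by move=> x _; exact: coord_continuous.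
split=> [x _|v]; first exact: differentiable_coord.
rewrite (_ : (fun _ => _) = cst (v 0 j)); first exact: Ck_cst.
apply/funext => x; rewrite -(@diff_coord n n id x j v).
  by rewrite (@diff_lin _ _ _ idfun) // => ?; exact: cvg_id.
by move=> i; exact: differentiable_coord.
Qed.

(* Unlike in [Ck_comp], [h] is only C^k: this is what lets the regularity of an
inverse function be bootstrapped from C^k to C^(k+1). *)
Lemma Ck_compk k m n (U : set 'rV[R]_n) (V : set 'rV[R]_m) f
    (h : 'rV[R]_m -> 'rV[R]_n) : open V ->
  (forall x, V x -> {for x, continuous h}) ->
  (forall j, Ck k V (fun x => h x 0 j)) ->
  (forall x, V x -> U (h x)) -> Ck k U f -> Ck k V (f \o h).
Proof.
move=> Vo hc + hVU; elim: k f => [|k IH] f hs.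
  by move=> Cf x Vx; apply: continuous_comp; [exact: hc|exact/Cf/hVU].
move=> Cf; have [df Df] := Cf.
have dh x (Vx : V x) : differentiable h x.
  by apply: differentiable_rV => j; exact: (hs j).1 x Vx.
split=> [x Vx|v].
  by apply: differentiable_comp; [exact: dh|exact/df/hVU].
have : Ck k V (fun x => \sum_j 'D_v (fun x => h x 0 j) x *
                          ((fun y => 'D_(delta_mx 0 j) f y) \o h) x).
  apply: Ck_sum => // j; apply: CkM => //; last first.
    by apply: IH (Df _) => i; exact: CkW.
  by case: (hs j) => _; apply.
apply: Ck_ext => // x Vx.
have dfh := df _ (hVU x Vx); have dhx := dh x Vx.
rewrite deriveE; last exact: differentiable_comp.
rewrite diff_comp // -[RHS]/('d f (h x) ('d h x v)).
rewrite [X in 'd f (h x) X]row_sum_delta linear_sum; apply: eq_bigr => j _.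
rewrite linearZ /= (deriveE _ dfh) diff_coord // => i.
exact: (hs i).1 x Vx.
Qed.

Lemma Ck_prod k n p (U : set 'rV[R]_n) (f : 'I_p -> 'rV[R]_n -> R) : open U ->
  (forall i, Ck k U (f i)) -> Ck k U (fun x => \prod_i f i x).
Proof.
move=> Uo; elim: p f => [|p IH] f Cf.
  by under eq_fun do rewrite big_ord0; exact: Ck_cst.
by under eq_fun do rewrite big_ord_recl; apply: CkM => //; exact: IH.
Qed.

Lemma Ck_sum_fin k n (I : finType) (U : set 'rV[R]_n) (f : I -> 'rV[R]_n -> R) : open U ->
  (forall i, Ck k U (f i)) -> Ck k U (fun x => \sum_i f i x).
Proof.
move=> Uo Cf.
have -> : (fun x => \sum_i f i x) = fun x => \sum_(i < #|I|) f (enum_val i) x.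
  by apply/funext => x; rewrite -(big_enum_val (fun i => f i x)).
by apply: Ck_sum => // i; exact: Cf.
Qed.

Lemma Ck_det k n p (U : set 'rV[R]_n) (A : 'rV[R]_n -> 'M[R]_p) : open U ->
  (forall i j, Ck k U (fun x => A x i j)) -> Ck k U (fun x => \det (A x)).
Proof.
move=> Uo CA; rewrite /determinant; apply: Ck_sum_fin => // s.
by apply: CkM => //; [exact: Ck_cst|apply: Ck_prod => // i; exact: CA].
Qed.

(** The derivative of 1/f is -f'/f^2, which involves 1/f only to the order supplied by the
    induction. *)
Lemma Ck_inv k n (U : set 'rV[R]_n) f : open U -> (forall x, U x -> f x != 0) ->
  Ck k U f -> Ck k U (fun x => (f x)^-1).
Proof.
move=> Uo f0; elim: k => [|k IH] Cf.
  by move=> x Ux; exact: cvgV (f0 x Ux) (Cf x Ux).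
have [df Df] := Cf; split=> [x Ux|v].
  by apply: differentiableV; [exact: df|exact: f0].
have := CkM Uo (CkM Uo (IH (CkW Cf)) (IH (CkW Cf))) (CkM Uo (Ck_cst k U (- 1)) (Df v)).
apply: Ck_ext => // x Ux /=.
rewrite [RHS]deriveV ?f0 //; last exact/diff_derivable/df.
by rewrite /GRing.scale /= mulN1r mulrN mulNr -invfM expr2.
Qed.

Lemma Ck_invmx k n p (U : set 'rV[R]_n) (A : 'rV[R]_n -> 'M[R]_p) : open U ->
  (forall x, U x -> \det (A x) != 0) ->
  (forall i j, Ck k U (fun x => A x i j)) ->
  forall i j, Ck k U (fun x => invmx (A x) i j).
Proof.
move=> Uo A0 CA i j.
(* Cramer's rule: the entries of the inverse are polynomials in those of [A], divided by the
   determinant. *)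
have C : Ck k U (fun x => (\det (A x))^-1 * (\adj (A x)) i j).
  apply: CkM => //; first by apply: Ck_inv => //; exact: Ck_det.
  under eq_fun do rewrite mxE /cofactor.
  apply: CkM => //; first exact: Ck_cst.
  by apply: Ck_det => // a b; under eq_fun do rewrite !mxE; exact: CA.
apply: Ck_ext C => // x Ux.
by rewrite /invmx unitmxE unitfE A0 // [RHS]mxE.
Qed.

Lemma smooth_on_mulmx m n (U : set 'rV[R]_m) (L : 'M[R]_(m, n)) :
  smooth_on U (fun v => v *m L).
Proof.
move=> k j; apply: (@CkS _ k m setT) => //; under eq_fun do rewrite mxE.
apply: Ck_sum => [|i]; first exact: openT.
by apply: CkM; [exact: openT|exact: Ck_coord|exact: Ck_cst].
Qed.

Lemma smooth_onD m n (U : set 'rV[R]_m) (f g : 'rV[R]_m -> 'rV[R]_n) : open U ->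
  smooth_on U f -> smooth_on U g -> smooth_on U (fun x => f x + g x).
Proof.
by move=> Uo fs gs k j; under eq_fun do rewrite mxE; apply: CkD; [|exact: fs|exact: gs].
Qed.

Lemma smooth_on_cst m n (U : set 'rV[R]_m) (c : 'rV[R]_n) : smooth_on U (fun=> c).
Proof. by move=> k j; exact: Ck_cst. Qed.

Lemma smooth_on_diff m n (U : set 'rV[R]_m) (f : 'rV[R]_m -> 'rV[R]_n) x :
  smooth_on U f -> U x -> forall j, differentiable (fun x => f x 0 j) x.
Proof. by move=> fs Ux j; exact: (fs 1%N j).1. Qed.

End SmoothFunctions.

(** * The inverse function theorem *)

Section MeanValue.
Context {R : realType}.
Local Open Scope ring_scope.

Lemma mean_value_le n (f : 'rV[R]_n -> R) (x y : 'rV[R]_n) c :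
  (forall t : R, 0 <= t <= 1 -> differentiable f (x + t *: (y - x))) ->
  (forall t : R, 0 <= t <= 1 -> `|'D_(y - x) f (x + t *: (y - x))| <= c) ->
  `|f y - f x| <= c.
Proof.
move=> df fc; pose g (t : R) := f (x + t *: (y - x)).
have dg (t : R) : 0 <= t <= 1 -> is_derive t 1 g ('D_(y - x) f (x + t *: (y - x))).
  move=> /df /(@diff_derivable _ _ _ f _ (y - x)).
  rewrite /derivable => dft.
  have E : (fun h : R => h^-1 *: ((g \o shift t) (h *: 1) - g t)) =
      (fun h => h^-1 *: ((f \o shift (x + t *: (y - x))) (h *: (y - x)) -
        f (x + t *: (y - x)))).
    apply/funext => h; rewrite /g /=; congr (_ *: (f _ - _)).
    by rewrite [h *: 1]mulr1 scalerDl addrCA.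
  by split; rewrite /derivable /derive E.
have [||t ti] := @MVT_segment R g (fun t => 'D_(y - x) f (x + t *: (y - x))) 0 1 ler01.
- by move=> t; rewrite in_itv /= => /andP[/ltW t0 /ltW t1]; apply: dg; rewrite t0 t1.
- by apply: derivable_within_continuous => t; rewrite in_itv /= => /dg [].
rewrite subr0 mulr1 /g scale1r scale0r addr0 [_ + (_ - _)]addrC subrK => ->.
by apply: fc; move: ti; rewrite in_itv.
Qed.

Lemma derive_partial n (f : 'rV[R]_n -> R) x v : differentiable f x ->
  'D_v f x = \sum_i v 0 i * 'D_(delta_mx 0 i) f x.
Proof.
move=> df; rewrite deriveE // [in LHS](row_sum_delta v) linear_sum.
by apply: eq_bigr => i _; rewrite linearZ /= deriveE.
Qed.

(** The norm is the sup norm, so the derivative along x - y is a sum of n terms, each at most q |x -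
    y|; hence the factor n. The ball is convex and contains the segment on which the mean value
    theorem is used. *)
Lemma lipschitz_ball n p (g : 'rV[R]_n -> 'rV[R]_p) (D : R) (q : R) : 0 <= q ->
  (forall x, `|x| <= D -> forall j, differentiable (fun x => g x 0 j) x) ->
  (forall x, `|x| <= D -> forall i j, `|'D_(delta_mx 0 i) (fun x => g x 0 j) x| <= q) ->
  forall x y, `|x| <= D -> `|y| <= D -> `|g x - g y| <= (n%:R * q) * `|x - y|.
Proof.
move=> q0 dg gq x y xD yD; apply: norm_rV_le.
  by rewrite !mulr_ge0.
move=> j; rewrite !mxE.
have inD t : 0 <= t <= 1 -> `|y + t *: (x - y)| <= D.
  move=> /andP[t0 t1].
  have -> : y + t *: (x - y) = t *: x + (1 - t) *: y.
    by rewrite scalerBr scalerBl scale1r addrC addrAC -addrA.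
  rewrite (le_trans (ler_normD _ _)) // !normrZ (ger0_norm t0) ger0_norm ?subr_ge0 //.
  have : t * `|x| <= t * D by apply: ler_wpM2l.
  have : (1 - t) * `|y| <= (1 - t) * D by apply: ler_wpM2l => //; rewrite subr_ge0.
  lra.
apply: (mean_value_le (f := fun x => g x 0 j)) => t /inD Dt; first exact: dg.
have dgt := dg _ Dt j.
rewrite derive_partial //.
apply: le_trans (ler_norm_sum _ _ _) _.
rewrite -[n in n%:R]card_ord -sumr_const !mulr_suml; apply: ler_sum => i _.
rewrite normrM mul1r mulrC; apply: ler_pM => //; first exact: gq.
exact: le_coord.
Qed.

End MeanValue.

(** * Smoothness of a Lipschitz right inverse *)

Section InverseRegularity.
Context {R : realType}.
Local Open Scope ring_scope.

(** The Lipschitz bound turns the first-order expansion of [k] at [s y] into one of [s] at [y], with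
    the inverse matrix as differential. The partial derivatives of [s] are then entries of the
    inverse Jacobian composed with [s], so each order of regularity of [s] yields the next. *)
Lemma smooth_inverse n (W V : set 'rV[R]_n) (k s : 'rV[R]_n -> 'rV[R]_n) (c : R) :
  open W -> open V -> smooth_on W k -> (forall x, W x -> \det (jac k x) != 0) ->
  (forall y, V y -> W (s y) /\ k (s y) = y) -> 0 < c ->
  (forall y z, V y -> V z -> `|s y - s z| <= c * `|y - z|) -> smooth_on V s.
Proof.
move=> Wo Vo ks kd ksV c0 sl.
have uj y : V y -> jac k (s y) \in unitmx.
  by move=> /ksV[/kd + _]; rewrite unitmxE unitfE.
have ds y : V y -> differentiable s y /\
    'd s y = (fun v => v *m invmx (jac k (s y))) :> (_ -> _).
  move=> Vy; pose l := mulmxr (invmx (jac k (s y))) : {linear 'rV[R]_n -> 'rV[R]_n}.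
  have cl : continuous l by exact: mulmx_coord_continuous.
  apply: (@differentiableP_eps _ _ _ s y l cl) => e e0.
  have [K K0 lK] := linear_lipschitz cl.
  have [Wsy ksy] := ksV y Vy.
  have dk : differentiable k (s y).
    by apply: differentiable_rV; exact: smooth_on_diff ks Wsy.
  (* The remainder of [k] is at most this tolerance times |t|, with |t| <= c |d|, and [l] enlarges
     it by at most [K]: together e |d|. *)
  have e1 : 0 < e / (K * c) by rewrite divr_gt0 // mulr_gt0.
  have /nbhs_normP[r /= r0 rk] := differentiable_eps dk e1.
  have nV : \forall d \near (0 : 'rV[R]_n), V (d + y).
    have : \forall z \near y, V z by exact: open_nbhs_nbhs.
    by rewrite (near_shift (0 : 'rV[R]_n)) subr0.
  have nr : \forall d \near (0 : 'rV[R]_n), `|d| < r / c.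
    by apply: nbhs0_lt; rewrite divr_gt0.
  near=> d.
  have Vd : V (d + y) by near: d.
  have dr : `|d| < r / c by near: d.
  pose t := s (d + y) - s y.
  have td : `|t| <= c * `|d| by have := sl _ _ Vd Vy; rewrite addrK.
  have tr : `|t| < r by apply: le_lt_trans td _; rewrite mulrC -ltr_pdivlMr.
  have := rk t; rewrite /ball_ /= sub0r normrN => /(_ tr).
  rewrite diff_jac; last exact: smooth_on_diff ks Wsy.
  rewrite /t subrK -/t (ksV _ Vd).2 ksy addrK => H.
  (* As [l] inverts the Jacobian, the remainder of [s] is minus the image under [l] of the remainder
     of [k]. *)
  have -> : t - l d = - l (d - t *m jac k (s y)).
    by rewrite linearB /= mulmxK ?uj // opprB.
  rewrite normrN; apply: le_trans (lK _) _.
  have -> : e * `|d| = K * (e / (K * c) * (c * `|d|)).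
    by rewrite invfM; field; rewrite !gt_eqF.
  apply: ler_wpM2l; first exact: ltW.
  by rewrite (le_trans H) // ler_wpM2l // ltW.
have sc y : V y -> {for y, continuous s}.
  by move=> /ds[] + _; exact: differentiable_continuous.
elim=> [|p IH] j.
  move=> y /sc sy; apply: (@continuous_comp _ _ _ s (fun v : 'rV[R]_n => v 0 j)) => //.
  exact: coord_continuous.
have dsj y i : V y -> differentiable (fun y => s y 0 i) y.
  move=> /ds[dsy _].
  apply: (@differentiable_comp _ _ _ _ s (fun v : 'rV[R]_n => v 0 i)) => //.
  exact: differentiable_coord.
split=> [y /dsj//|v].
(* Bootstrap: [F] is smooth on [W] and [s] is C^p by induction, so the derivative of [s] is C^p. *)
pose F i j x := invmx (jac k x) i j.
have CF i j' : Ck p W (F i j').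
  apply: Ck_invmx => // a b.
  under eq_fun do rewrite mxE.
  by have [_] := ks p.+1 b; exact.
have : Ck p V (fun y => \sum_i v 0 i * (F i j \o s) y).
  apply: Ck_sum => // i; apply: CkM => //; first exact: Ck_cst.
  by apply: Ck_compk (CF i j) => // x /ksV[].
apply: Ck_ext => // y Vy.
rewrite -diff_coord => [|i]; last exact: dsj.
by rewrite (ds y Vy).2 mxE.
Unshelve. all: by end_near. Qed.

End InverseRegularity.

(** * Existence of local inverses and local sections *)

Section InverseFunction.
Context {R : realType}.
Local Open Scope ring_scope.

Lemma near_jac_id n (W : set 'rV[R]_n) (k : 'rV[R]_n -> 'rV[R]_n) (q : R) :
  open W -> W 0 -> smooth_on W k -> jac k 0 = 1%:M -> 0 < q ->
  exists2 D, 0 < D & forall x : 'rV[R]_n, `|x| < D ->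
    [/\ W x, \det (jac k x) != 0 &
        forall i j, `|(1%:M - jac k x) i j| <= q].
Proof.
move=> Wo W0 ks k0 q0.
have Cj i j : Ck 0 W (fun x => jac k x i j).
  under eq_fun do rewrite mxE.
  by have [_ /(_ (delta_mx 0 i))] := ks 1%N j.
have n1 : \forall x \near (0 : 'rV[R]_n), W x by exact: open_nbhs_nbhs.
have n2 : \forall x \near (0 : 'rV[R]_n), \det (jac k x) != 0.
  have Cd : Ck 0 W (fun x => \det (jac k x)).
    by apply: Ck_det => // i j; exact: Cj.
  have := Cd 0 W0; rewrite /= => Cd0.
  have : \forall y \near \det (jac k 0), y != 0.
    by apply: open_nbhs_nbhs; split; [exact: open_neq|rewrite /= k0 det1 oner_eq0].
  exact: Cd0.
have n3 : \forall x \near (0 : 'rV[R]_n), forall i j, `|(1%:M - jac k x) i j| <= q.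
  apply: (@filter_forall _ _ (fun i x => forall j, `|(1%:M - jac k x) i j| <= q)
    (nbhs (0 : 'rV[R]_n)) _) => i.
  apply: (@filter_forall _ _ (fun j x => `|(1%:M - jac k x) i j| <= q)
    (nbhs (0 : 'rV[R]_n)) _) => j.
  have /cvgr_dist_lt /(_ q q0) := Cj i j 0 W0.
  apply: filterS => x; rewrite k0 => /ltW.
  suff -> : (1%:M - jac k x) i j = 1%:M i j - jac k x i j by [].
  by rewrite !mxE.
have /nbhs_normP[r /= r0 rk] : \forall x \near (0 : 'rV[R]_n),
    [/\ W x, \det (jac k x) != 0 & forall i j, `|(1%:M - jac k x) i j| <= q].
  by apply: filterS3 n1 n2 n3.
by exists r => // x xr; apply: rk; rewrite /ball_ /= sub0r normrN.
Qed.

Lemma local_inverse n (W : set 'rV[R]_n) (k : 'rV[R]_n -> 'rV[R]_n) :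
  open W -> W 0 -> smooth_on W k -> jac k 0 = 1%:M ->
  exists V s, [/\ open V, V (k 0), smooth_on V s &
    forall y, V y -> W (s y) /\ k (s y) = y].
Proof.
move=> Wo W0 ks k0.
(* Chosen so that n q <= 1/2, which makes [g] below a contraction of ratio 1/2; n + 1 instead of n
   covers dimension 0. *)
pose q : R := (2 * n.+1%:R)^-1.
have q0 : 0 < q by rewrite invr_gt0 mulr_gt0.
have [r r0 kr] := near_jac_id Wo W0 ks k0 q0.
pose D := r / 2; have D0 : 0 < D by rewrite divr_gt0.
have Dr (x : 'rV[R]_n) : `|x| <= D -> `|x| < r by rewrite /D; lra.
have kD (x : 'rV[R]_n) (xD : `|x| <= D) := kr x (Dr x xD).
pose g (x : 'rV[R]_n) : 'rV[R]_n := x - k x.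
have dk (x : 'rV[R]_n) : `|x| <= D -> forall j, differentiable (fun x => k x 0 j) x.
  by move=> /kD[Wx _ _]; exact: smooth_on_diff ks Wx.
have gE j : (fun x => g x 0 j) =
    (fun x : 'rV[R]_n => x 0 j) - (fun x => k x 0 j) :> ('rV[R]_n -> R).
  by apply/funext => x; rewrite /g !mxE.
have dg (x : 'rV[R]_n) : `|x| <= D -> forall j, differentiable (fun x => g x 0 j) x.
  move=> /dk dkx j; rewrite gE; apply: differentiableB => //.
  exact: differentiable_coord.
have gq (x : 'rV[R]_n) : `|x| <= D ->
    forall i j, `|'D_(delta_mx 0 i) (fun x => g x 0 j) x| <= q.
  move=> xD i j; have [_ _ /(_ i j)] := kD x xD; congr (`|_| <= _).
  rewrite gE deriveB; [|exact/diff_derivable/differentiable_coord|exact/diff_derivable/dk].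
  rewrite !mxE; congr (_ - _).
  rewrite -(@diff_coord _ n n id x j); last by move=> ?; exact: differentiable_coord.
  by rewrite (@diff_lin _ _ _ idfun) ?mxE 1?eq_sym // => ?; exact: cvg_id.
have gl (x y : 'rV[R]_n) : `|x| <= D -> `|y| <= D -> `|g x - g y| <= 2^-1 * `|x - y|.
  move=> xD yD; apply: le_trans (lipschitz_ball (ltW q0) dg gq xD yD) _.
  rewrite ler_wpM2r // /q invfM mulrCA ger_pMr ?invr_gt0 //.
  by rewrite ler_pdivrMr // mul1r ler_nat.
pose B : set 'rV[R]_n := [set x | `|x| <= D].
have Bcl : closed B.
  have := @closed_closed_ball_ _ _ (0 : 'rV[R]_n) D.
  by rewrite /closed_ball_; under eq_set do rewrite sub0r normrN.
(* k x = y means that x is fixed by x |-> x - k x + y, a contraction of B. *)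
have fixp y : `|y - k 0| < D / 2 -> exists2 x, B x & k x = y.
  move=> yD; pose T x := g x + y.
  (* [g] displaces its value at 0 by at most D/2 on the ball, which leaves D/2 for the distance from
     [y] to [k 0]. *)
  have TB : set_fun B B T.
    move=> x xD; rewrite /B /= /T.
    have -> : g x + y = (g x - g 0) + (y - k 0).
      by rewrite /g sub0r opprK -[RHS]addrA [k 0 + _]addrC subrK.
    apply: le_trans (ler_normD _ _) _.
    have := gl x 0 xD; rewrite normr0 subr0 => /(_ (ltW D0)).
    move: xD; rewrite /B /=; lra.
  pose TM := isFun.Build _ _ B B T TB.
  pose Tf : {fun B >-> B} := HB.pack T TM.
  have ct : is_contraction Tf.
    exists (2^-1)%:nng; split; first by rewrite /= invf_lt1 // ltr1n.
    move=> [x z] [/= xB zB]; rewrite /T opprD addrACA subrr addr0; exact: gl.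
  pose rVc : completeNormedModType R := HB.pack 'rV[R]_n (Complete.on 'rV[R]_n).
  have [|x xB] := @banach_fixed_point R rVc B Tf ct Bcl.
    by exists 0; rewrite /B /= normr0 ltW.
  rewrite /= /T /g => /eqP.
  rewrite -subr_eq0 opprD opprB addrA addrCA subrr addr0 subr_eq0 => /eqP xE.
  by exists x.
pose V : set 'rV[R]_n := [set y | `|y - k 0| < D / 2].
have Vo : open V.
  have := ball_open (k 0) (D / 2).
  by rewrite -ball_normE /ball_ /=; under eq_set do rewrite distrC.
(* Off [V] the value 0 is junk; it makes the choice of [s] total. *)
have {}fixp y : exists x, V y -> B x /\ k x = y.
  by have [/fixp[x]|] := pselect (V y); [exists x|exists 0].
have [s sE] := choice fixp.
exists V, s; split.
- exact: Vo.
- by rewrite /V /= subrr normr0 divr_gt0.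
- pose W' : set 'rV[R]_n := [set x | `|x| < r].
  have W'o : open W'.
    have := ball_open (0 : 'rV[R]_n) r.
    by rewrite -ball_normE /ball_ /=; under eq_set do rewrite sub0r normrN.
  have ks' : smooth_on W' k by move=> p j; apply: CkS (ks p j) => x /kr[].
  (* The constant 2: with a = |s y - s z|, the contraction estimate gives a <= a/2 + |y - z|. *)
  apply: (smooth_inverse (W := W') (k := k) (c := 2)) => //.
  + by move=> x /kr[].
  + by move=> y /sE[/Dr].
  + move=> y z /sE[yB yk] /sE[zB zk].
    have := gl _ _ yB zB; rewrite /g yk zk opprD addrACA -opprD.
    have := ler_normD (s y - s z - (y - z)) (y - z); rewrite subrK.
    lra.
- by move=> y /sE[/kD[]].
Qed.

(** The rows of [L] are preimages of the basis vectors, so [L] is a right inverse of the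
    differential at [u]. Along the affine slice u + v L the map [h] has identity Jacobian at 0, and
    [local_inverse] applies. *)
Lemma local_section m n (U : set 'rV[R]_m) (h : 'rV[R]_m -> 'rV[R]_n) u :
  open U -> U u -> smooth_on U h -> (forall w, exists v, 'd h u v = w) ->
  exists V s, [/\ open V, V (h u), smooth_on V s &
    forall y, V y -> U (s y) /\ h (s y) = y].
Proof.
move=> Uo Uu hs hsurj.
have [f fE] := choice (fun i : 'I_n => hsurj (delta_mx 0 i)).
pose L : 'M[R]_(n, m) := \matrix_i f i.
pose a (v : 'rV[R]_n) : 'rV[R]_m := u + v *m L.
have as_ W : open W -> smooth_on W a.
  by move=> Wo; apply: smooth_onD Wo _ _; [exact: smooth_on_cst|exact: smooth_on_mulmx].
have a0 : a 0 = u by rewrite /a mul0mx addr0.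
pose W := a @^-1` U.
have Wo : open W.
  by have := open_preimage_smooth openT Uo (as_ _ openT); rewrite setTI.
have ks : smooth_on W (h \o a) by exact: smooth_on_comp (as_ _ Wo) _ hs.
have W0 : W 0 by rewrite /W /= a0.
have [da aE] : differentiable a 0 /\ 'd a 0 = mulmxr L :> (_ -> _).
  apply: differentiableP_eps; first exact: mulmx_coord_continuous.
  move=> e e0; apply: (@filterS _ (nbhs (0 : 'rV[R]_n)) _ setT _ _ filterT) => d _.
  by rewrite a0 addr0 /a (addrAC u) subrr add0r /= subrr normr0 mulr_ge0 // ltW.
have dh : differentiable h (a 0).
  by rewrite a0; apply: differentiable_rV => j; exact: smooth_on_diff hs Uu j.
have k0 : jac (h \o a) 0 = 1%:M.
  apply/row_matrixP => i; rewrite !rowE -diff_jac; last exact: smooth_on_diff ks W0.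
  rewrite diff_comp // -[LHS]/('d h (a 0) ('d a 0 _)).
  by rewrite aE a0 /= -rowE /L rowK fE mulmx1.
have [V [s [Vo Vk ss sV]]] := local_inverse Wo W0 ks k0.
exists V, (a \o s); split=> //; first by rewrite -{1}a0.
by apply: smooth_on_comp Vo ss _ (as_ _ openT).
Qed.

End InverseFunction.

(** * Diffeological spaces and subductions *)

Section Diffeology.
Context {R : realType}.
Local Open Scope ring_scope.
Implicit Types X Y Z : dspace R.

Lemma smooth_on_id n (U : set 'rV[R]_n) : smooth_on U id.
Proof. by move=> k j; exact: Ck_coord. Qed.

Lemma splotS X n (U V : set 'rV[R]_n) (p : 'rV[R]_n -> X) :
  open V -> V `<=` U -> splot U p -> splot V p.
Proof. by move=> Vo VU pU; apply: plot_comp pU Vo _ VU; exact: smooth_on_id. Qed.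

Lemma splot_ext X n (U : set 'rV[R]_n) (p q : 'rV[R]_n -> X) :
  (forall x, U x -> p x = q x) -> splot U p -> splot U q.
Proof.
move=> pq pU; have Uo := plot_open pU; apply: plot_local => // x Ux.
by exists U, p; split=> // y /pq.
Qed.

Lemma smooth_id X : smooth (@id X). Proof. by []. Qed.

Lemma smooth_comp X Y Z (f : X -> Y) (g : Y -> Z) :
  smooth f -> smooth g -> smooth (fun x => g (f x)).
Proof. by move=> fs gs n U p /fs/gs. Qed.

Lemma smooth_cst X Y (y : Y) : smooth (fun _ : X => y).
Proof. by move=> n U p /plot_open Uo; exact: plot_cst. Qed.

Lemma smooth_fst X Y : smooth (fst : prodS X Y -> X).
Proof. by move=> n U p []. Qed.

Lemma smooth_snd X Y : smooth (snd : prodS X Y -> Y).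
Proof. by move=> n U p []. Qed.

Lemma smooth_pair X Y Z (f : X -> Y) (g : X -> Z) :
  smooth f -> smooth g -> smooth (fun x => (f x, g x) : prodS Y Z).
Proof. by move=> fs gs n U p pU; split; [exact: fs pU|exact: gs pU]. Qed.

Lemma smooth_val X (A : set X) : smooth (fun a : subS A => val a : X).
Proof. by []. Qed.

Lemma smooth_sub X Y (A : set Y) (f : X -> subS A) :
  smooth (fun x => val (f x) : Y) -> smooth f.
Proof. by move=> fs n U p /fs. Qed.

Lemma smooth_pi X (I : Type) (Y : I -> dspace R) (f : X -> piS Y) :
  (forall i, smooth (fun x => f x i)) -> smooth f.
Proof.
by move=> fs n U p pU; split=> [|i]; [exact: plot_open pU|exact: fs pU].
Qed.

Lemma smooth_cls X (r : X -> X -> Prop) : smooth (cls r : X -> quotS r).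
Proof.
move=> n U p pU; split; first exact: plot_open pU.
by move=> x Ux; exists U, p; split.
Qed.

Lemma dopen_preimage X Y (f : X -> Y) (A : set Y) :
  smooth f -> dopen A -> dopen (f @^-1` A).
Proof. by move=> fs Ao n U p /fs/Ao. Qed.

Lemma dopenI X (A B : set X) : dopen A -> dopen B -> dopen (A `&` B).
Proof.
move=> Ao Bo n U p pU.
have -> : U `&` p @^-1` (A `&` B) = (U `&` p @^-1` A) `&` (U `&` p @^-1` B).
  by apply/seteqP; split=> x /=; tauto.
by apply: openI; [exact: Ao pU|exact: Bo pU].
Qed.

(** Plots are total functions, so a value in the subspace is needed off [U] as well; the point [u]
    provides it. *)
Lemma splot_sub X (A : set X) n (U : set 'rV[R]_n) (p : 'rV[R]_n -> X) u :
  U u -> splot U p -> (forall x, U x -> A (p x)) ->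
  exists2 q : 'rV[R]_n -> subS A, splot U q & forall x, U x -> val (q x) = p x.
Proof.
move=> Uu pU pA.
have /choice[q qE] (x : 'rV[R]_n) : exists a : subS A, U x -> val a = p x.
  have [Ux|nUx] := pselect (U x); first by exists (mkS (pA x Ux)).
  by exists (mkS (pA u Uu)).
by exists q => //; apply: splot_ext pU => x /qE.
Qed.

(** The diffeological form of a surjective submersion. Surjectivity is contained in it: lift
    constant plots. *)
Definition subduction X Y (f : X -> Y) := smooth f /\
  forall n (U : set 'rV[R]_n) q u, splot U q -> U u ->
    exists V p, [/\ V u, V `<=` U, splot V p & forall v, V v -> f (p v) = q v].

(** Plots of the target lift locally through [f], and being a plot is a local property. *)
Lemma smooth_desc X Y Z (f : X -> Y) (g : Y -> Z) :
  subduction f -> smooth (fun x => g (f x)) -> smooth g.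
Proof.
move=> [_ fl] gfs n U q qU; have Uo := plot_open qU.
apply: plot_local => // u /(fl _ _ _ _ qU)[V [p [Vu VU pV fp]]].
exists V, (fun x => g (f (p x))); split=> //; first exact: (gfs _ _ _ pV).
by move=> y /fp /= ->.
Qed.

Lemma subduction_cls X (r : X -> X -> Prop) : subduction (cls r : X -> quotS r).
Proof.
split=> [|n U q u [_ qU] /qU [V [p [Vu VU pV qp]]]]; first exact: smooth_cls.
by exists V, p; split=> // v /qp.
Qed.

Lemma subduction_prod X Y Z (f : X -> Y) : subduction f ->
  subduction (fun w : prodS X Z => (f w.1, w.2) : prodS Y Z).
Proof.
move=> [fs fl]; split.
  by apply: smooth_pair; [apply: smooth_comp fs; exact: smooth_fst|exact: smooth_snd].
move=> n U q u [q1 q2] Uu; have [V [p [Vu VU pV fp]]] := fl _ _ _ _ q1 Uu.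
exists V, (fun x => (p x, (q x).2)); split=> //.
  by split=> //; apply: splotS q2 => //; exact: plot_open pV.
by move=> v /fp /= ->; rewrite -surjective_pairing.
Qed.

(** The plot is read in the chart of the target as a smooth map [g], and [g] is followed by a smooth
    local section of the local expression [h]. *)
Lemma surj_submersion_subduction X Y (f : X -> Y) :
  is_surj_submersion f -> subduction f.
Proof.
move=> [[fs fsub] fsurj]; split=> // n0 U0 q u0 qU Uu0.
have [x fx] := fsurj (q u0).
have [m [n [U [phi [V [psi [u [h [[phiU _ _ _] [Uu phiu]
  [psiV psii psio psis] nh [dh hs]]]]]]]]]] := fsub x.
have Uo := plot_open phiU.
have nU : \forall a \near u, U a /\ (V (h a) /\ psi (h a) = f (phi a)).
  by apply: filterI => //; exact: open_nbhs_nbhs.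
rewrite -nbhs_nearE nbhsE in nU; have {nU} [N [No Nu] NU] := nU.
(* Differentiability of [h] is given at [u] only; smoothness around [u] follows because [psi] is a
   chart and [psi] after [h] is [f] after [phi]. *)
have hN : smooth_on N h.
  apply: psis => [a /NU[_ []]//|]; apply: (@splot_ext _ _ _ (f \o phi)).
    by move=> a /NU[_ []].
  by apply: fs; apply: splotS phiU => // a /NU[].
have [W [s [Wo Wu ss sW]]] := local_section No Nu hN hs.
have U1o := psio _ _ _ qU.
set U1 := _ `&` _ in U1o.
have /choice[g gE] v : exists w, U1 v -> V w /\ psi w = q v.
  have [[_ [w Vw wE]]|nU1] := pselect (U1 v); first by exists w.
  by exists 0.
have gs : smooth_on U1 g.
  apply: psis => [v /gE[]//|]; apply: (@splot_ext _ _ _ q).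
    by move=> v /gE[].
  by apply: splotS qU => // v [].
have [Vu fu] := (NU _ Nu).2.
have U1u : U1 u0 by split=> //=; exists (h u); rewrite // fu phiu.
(* The local section is defined near [h u]; this equality puts [u0] in the domain of the lift. *)
have gu : g u0 = h u.
  have [Vg gq] := gE _ U1u.
  by apply: psii => //; rewrite gq fu phiu.
have gWo := open_preimage_smooth U1o Wo gs.
exists (U1 `&` g @^-1` W), (phi \o (s \o g)); split.
- by split=> //=; rewrite gu.
- by move=> v [[]].
- apply: (plot_comp phiU gWo).
    apply: (smooth_on_comp gWo) ss => [k j|v []//].
    by apply: CkS (gs k j) => v [].
  by move=> v [_ /sW[/NU[]]].
- move=> v [U1v /sW[Ns hsg]] /=.
  by have [_ [_ <-]] := NU _ Ns; rewrite hsg; case: (gE _ U1v).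
Qed.

End Diffeology.

(** * Products of manifolds and submersions *)

Section Products.
Context {R : realType}.
Local Open Scope ring_scope.
Implicit Types X Y Z : dspace R.

Lemma smooth_on_lsubmx m n (U : set 'rV[R]_(m + n)) : smooth_on U lsubmx.
Proof. by move=> k j; under eq_fun do rewrite mxE; exact: Ck_coord. Qed.

Lemma smooth_on_rsubmx m n (U : set 'rV[R]_(m + n)) : smooth_on U rsubmx.
Proof. by move=> k j; under eq_fun do rewrite mxE; exact: Ck_coord. Qed.

Lemma smooth_on_row_mx m n p (U : set 'rV[R]_p) (f : 'rV[R]_p -> 'rV[R]_m)
    (g : 'rV[R]_p -> 'rV[R]_n) :
  smooth_on U f -> smooth_on U g -> smooth_on U (fun x => row_mx (f x) (g x)).
Proof.
move=> fs gs k j; case: (split_ordP j) => i ->.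
  by under eq_fun do rewrite row_mxEl; exact: fs.
by under eq_fun do rewrite row_mxEr; exact: gs.
Qed.

Definition prod_dom m n (U : set 'rV[R]_m) (V : set 'rV[R]_n) : set 'rV[R]_(m + n) :=
  [set w | U (lsubmx w) /\ V (rsubmx w)].

Definition prod_chart X Y m n (phi : 'rV[R]_m -> X) (psi : 'rV[R]_n -> Y)
  (w : 'rV[R]_(m + n)) : prodS X Y := (phi (lsubmx w), psi (rsubmx w)).

Lemma open_prod_dom m n (U : set 'rV[R]_m) (V : set 'rV[R]_n) :
  open U -> open V -> open (prod_dom U V).
Proof.
move=> Uo Vo.
have := open_preimage_smooth openT Uo (@smooth_on_lsubmx m n setT).
have := open_preimage_smooth openT Vo (@smooth_on_rsubmx m n setT).
by rewrite !setTI => Vo' Uo'; exact: openI Uo' Vo'.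
Qed.

Lemma is_chart_prod X Y m n (U : set 'rV[R]_m) (V : set 'rV[R]_n)
    (phi : 'rV[R]_m -> X) (psi : 'rV[R]_n -> Y) :
  is_chart U phi -> is_chart V psi -> is_chart (prod_dom U V) (prod_chart phi psi).
Proof.
move=> [phiU phii phio phis] [psiV psii psio psis].
have UVo := open_prod_dom (plot_open phiU) (plot_open psiV); split.
- split.
    by apply: plot_comp phiU UVo (@smooth_on_lsubmx _ _ _) _ => w [].
  by apply: plot_comp psiV UVo (@smooth_on_rsubmx _ _ _) _ => w [].
- move=> x y [Ux Vx] [Uy Vy] [/phii xy1 /psii xy2].
  by rewrite -(hsubmxK x) -(hsubmxK y) xy1 // xy2.
- have -> : prod_chart phi psi @` prod_dom U V =
      (fst @^-1` (phi @` U)) `&` (snd @^-1` (psi @` V)) :> set (prodS X Y).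
    apply/seteqP; split=> [_ [w [Uw Vw] <-]|[x y] [[u Uu /= ux] [v Vv /= vy]]].
      by split; [exists (lsubmx w)|exists (rsubmx w)].
    exists (row_mx u v); first by split; rewrite ?row_mxKl ?row_mxKr.
    by rewrite /prod_chart row_mxKl row_mxKr ux vy.
  apply: dopenI; apply: dopen_preimage => //; [exact: smooth_fst|exact: smooth_snd].
- move=> p W g gUV [g1 g2].
  have s1 : smooth_on W (fun x => lsubmx (g x)) by apply: phis => // x /gUV[].
  have s2 : smooth_on W (fun x => rsubmx (g x)) by apply: psis => // x /gUV[].
  have := smooth_on_row_mx s1 s2.
  by under eq_fun do rewrite hsubmxK.
Qed.

Lemma is_manifold_prod X Y : is_manifold X -> is_manifold Y -> is_manifold (prodS X Y).
Proof.
move=> [Xh [m [C [Cc CX CXs]]]] [Yh [n [D [Dc DY DYs]]]]; split.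
  move=> [x y] [x' y'] xy.
  have [xx'|/Xh[A [B [Ao Bo Ax Bx AB]]]] := pselect (x = x').
    have [|A [B [Ao Bo Ay By AB]]] := Yh y y'; first by move=> yy'; rewrite xx' yy' in xy.
    exists (snd @^-1` A), (snd @^-1` B); split=> //;
      try (apply: dopen_preimage => //; exact: smooth_snd).
    by rewrite -preimage_setI AB preimage_set0.
  exists (fst @^-1` A), (fst @^-1` B); split=> //;
    try (apply: dopen_preimage => //; exact: smooth_fst).
  by rewrite -preimage_setI AB preimage_set0.
exists (m + n)%N.
pose F (cd : (set 'rV[R]_m * ('rV[R]_m -> X)) * (set 'rV[R]_n * ('rV[R]_n -> Y))) :
  set 'rV[R]_(m + n) * ('rV[R]_(m + n) -> prodS X Y) :=
  (prod_dom cd.1.1 cd.2.1, prod_chart cd.1.2 cd.2.2).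
exists (F @` (C `*` D)); split.
- apply: sub_countable (countableX Cc Dc); exact: card_image_le.
- by move=> _ [cd [/CX c1 /DY d1] <-]; exact: is_chart_prod.
- move=> [x y]; have [c Cc1 [u Uu ux]] := CXs x; have [d Dd1 [v Vv vy]] := DYs y.
  exists (F (c, d)); first by exists (c, d).
  exists (row_mx u v); first by split; rewrite ?row_mxKl ?row_mxKr.
  by rewrite /F /prod_chart /= row_mxKl row_mxKr ux vy.
Qed.

Lemma differentiable_comp_coord (V : normedModType R) n (h : V -> 'rV[R]_n) x j :
  differentiable h x -> differentiable (fun x => h x 0 j) x.
Proof.
move=> dh; apply: (@differentiable_comp _ _ _ _ h (fun v : 'rV[R]_n => v 0 j)) => //.
exact: differentiable_coord.
Qed.

Lemma diff_row_mx m n p (f : 'rV[R]_m -> 'rV[R]_n) (g : 'rV[R]_m -> 'rV[R]_p) u :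
  differentiable f u -> differentiable g u ->
  differentiable (fun w => row_mx (f w) (g w)) u /\
  forall v, 'd (fun w => row_mx (f w) (g w)) u v = row_mx ('d f u v) ('d g u v).
Proof.
move=> df dg.
have lE i : (fun w => row_mx (f w) (g w) 0 (lshift p i)) = fun w => f w 0 i.
  by apply/funext => w; rewrite row_mxEl.
have rE i : (fun w => row_mx (f w) (g w) 0 (rshift n i)) = fun w => g w 0 i.
  by apply/funext => w; rewrite row_mxEr.
have dc j : differentiable (fun w => row_mx (f w) (g w) 0 j) u.
  by case: (split_ordP j) => i ->; rewrite ?lE ?rE; exact: differentiable_comp_coord.
split=> [|v]; first exact: differentiable_rV.
apply/rowP => j; rewrite diff_coord //.
by case: (split_ordP j) => i ->; rewrite ?lE ?rE ?row_mxEl ?row_mxEr diff_coord // => ?;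
  exact: differentiable_comp_coord.
Qed.

(** With the same chart of [Z] on both sides, the local expression is [h] times the identity, and so
    is its differential. *)
Lemma is_submersion_prod X Y Z (f : X -> Y) : is_submersion f -> is_manifold Z ->
  is_submersion (fun w : prodS X Z => (f w.1, w.2) : prodS Y Z).
Proof.
move=> [fs fsub] [_ [p [D [_ DZ DZs]]]]; split.
  by apply: smooth_pair; [apply: smooth_comp fs; exact: smooth_fst|exact: smooth_snd].
move=> [x z].
have [m [n [U [phi [V [psi [u [h [phiU [Uu phiu] psiV nh [dh hs]]]]]]]]]] := fsub x.
have [[W chi] /= /DZ/= chiW [w Ww wz]] := DZs z.
have ld : differentiable (@lsubmx R 1 m p) (row_mx u w) by exact: differentiable_lsubmx.
have rd : differentiable (@rsubmx R 1 m p) (row_mx u w) by exact: differentiable_rsubmx.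
have dhl : differentiable h (lsubmx (row_mx u w)) by rewrite row_mxKl.
have [dH HE] := diff_row_mx (differentiable_comp ld dhl) rd.
exists (m + p)%N, (n + p)%N, (prod_dom U W), (prod_chart phi chi),
  (prod_dom V W), (prod_chart psi chi), (row_mx u w),
  (fun w => row_mx ((h \o lsubmx) w) (rsubmx w)); split.
- exact: is_chart_prod.
- split; first by split; rewrite ?row_mxKl ?row_mxKr.
  by rewrite /prod_chart row_mxKl row_mxKr phiu wz.
- exact: is_chart_prod.
- have Wo : open W by case: chiW => /plot_open.
  have l : \forall a \near row_mx u w,
      V (h (lsubmx a)) /\ psi (h (lsubmx a)) = f (phi (lsubmx a)).
    have cl : lsubmx @ row_mx u w --> lsubmx (row_mx u w).
      by apply: (@smooth_on_continuous _ _ _ setT) => //; exact: smooth_on_lsubmx.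
    by apply: (cl (fun b => V (h b) /\ psi (h b) = f (phi b))); rewrite row_mxKl.
  have r : \forall a \near row_mx u w, W (rsubmx a).
    have cl : rsubmx @ row_mx u w --> rsubmx (row_mx u w).
      by apply: (@smooth_on_continuous _ _ _ setT) => //; exact: smooth_on_rsubmx.
    by apply: (cl W); rewrite row_mxKr; exact: open_nbhs_nbhs.
  apply: filterS2 l r => a [Va psia] Wa.
  by rewrite /prod_dom /prod_chart /= !row_mxKl !row_mxKr psia.
- split=> // v; have [t tE] := hs (lsubmx v).
  exists (row_mx t (rsubmx v)); rewrite HE diff_comp //.
  rewrite -[X in row_mx X _]/('d h _ ('d lsubmx _ _)).
  have cl : continuous (@lsubmx R 1 m p).
    by move=> y; apply/differentiable_continuous/differentiable_lsubmx.
  have cr : continuous (@rsubmx R 1 m p).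
    by move=> y; apply/differentiable_continuous/differentiable_rsubmx.
  rewrite (diff_lin _ cl) (diff_lin _ cr) !row_mxKl /= row_mxKl row_mxKr tE; exact: hsubmxK.
Qed.

Lemma is_surj_submersion_prod X Y Z (f : X -> Y) : is_surj_submersion f ->
  is_manifold Z -> is_surj_submersion (fun w : prodS X Z => (f w.1, w.2) : prodS Y Z).
Proof.
move=> [fsub fsurj] Zm; split; first exact: is_submersion_prod.
by move=> [y z]; have [x <-] := fsurj y; exists (x, z).
Qed.

End Products.

(** * Principal U(1)-bundles *)

Section Circle.
Context {R : realType}.
Local Open Scope ring_scope.
Local Notation U := (U1 (R := R)).

Lemma u1_val_mulV (z : U) : (val z : R[i]) * (val (u1_inv z) : R[i]) = 1.
Proof. by rewrite /= mulfV // u1_neq0. Qed.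

Lemma u1_mulV (z : U) : u1_mul z (u1_inv z) = u1_one.
Proof. by apply: val_inj; exact: u1_val_mulV. Qed.

Lemma u1_mul1l (z : U) : u1_mul u1_one z = z.
Proof. by rewrite u1_mulC u1_mul1. Qed.

Lemma u1_mulVK (z w : U) : u1_mul z (u1_mul (u1_inv z) w) = w.
Proof. by rewrite u1_mulA u1_mulV u1_mul1l. Qed.

Lemma u1_invK (z : U) : u1_inv (u1_inv z) = z.
Proof. by apply: val_inj; rewrite /= invrK. Qed.

Lemma u1_mulI (z w w' : U) : u1_mul z w = u1_mul z w' -> w = w'.
Proof.
move=> /(congr1 (u1_mul (u1_inv z))).
by rewrite !u1_mulA ![u1_mul (u1_inv z) z]u1_mulC u1_mulV !u1_mul1l.
Qed.

Lemma u1_mul_div (a b z w : U) : u1_mul (u1_mul a z) (u1_inv (u1_mul b w)) =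
  u1_mul (u1_mul a (u1_inv b)) (u1_mul z (u1_inv w)).
Proof. by rewrite u1_invM; apply: val_inj; rewrite /= mulrACA. Qed.

Lemma smooth_u1_mul : smooth (fun zw : prodS U U => u1_mul zw.1 zw.2 : U).
Proof.
move=> n V p [[Vo p1] [_ p2]]; split=> // k.
have ReM (z w : R[i]) : complex.Re (z * w) =
    complex.Re z * complex.Re w + (- 1) * (complex.Im z * complex.Im w).
  by case: z w => [a b] [c d]; rewrite mulN1r.
have ImM (z w : R[i]) : complex.Im (z * w) =
    complex.Re z * complex.Im w + complex.Im z * complex.Re w.
  by case: z w => [a b] [c d].
have [r1 i1] := p1 k; have [r2 i2] := p2 k; split.
  under eq_fun do rewrite ReM.
  apply: CkD => //; apply: CkM => //; first exact: Ck_cst.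
  exact: CkM.
by under eq_fun do rewrite ImM; apply: CkD => //; apply: CkM.
Qed.

Lemma smooth_u1_inv : smooth (fun z : U => u1_inv z : U).
Proof.
move=> n V p [Vo pV]; split=> // k; have [r i] := pV k.
(* On the unit circle the inverse is the complex conjugate, which is linear in the real and
   imaginary parts. *)
have E x : (val (u1_inv (p x)) : R[i]) = ((val (p x) : R[i])^*)%C.
  by rewrite /= [LHS]invC_norm (set_valP (p x)) expr1n invr1 mul1r.
split; under eq_fun do rewrite E.
  by congr (Ck _ _ _): r; apply/funext => x; case: (val (p x) : R[i]).
have := CkM Vo (Ck_cst k V (- 1)) i; congr (Ck _ _ _); apply/funext => x.
by case: (val (p x) : R[i]) => a b; rewrite mulN1r.
Qed.

End Circle.

Section Bundles.
Context {R : realType}.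
Local Open Scope ring_scope.
Implicit Types X Y : dspace R.

Definition smooth_act X (P : u1_space X) :=
  smooth (fun pz : prodS P U1 => act pz.1 pz.2 : P).

(** The quotient q / p: the second argument is the numerator. Outside a common orbit the value 1 is
    junk. *)
Definition u1_div X (P : u1_space X) (p q : P) : U1 :=
  if pselect (exists z, q = act p z) is left e then projT1 (cid e) else u1_one.

Definition fib2 X (P : u1_space X) : set (prodS P P) :=
  [set pq | proj pq.1 = proj pq.2].

Section U1Bundle.
Variables (X : dspace R) (P : u1_space X).
Hypothesis Pb : is_u1_bundle P.

(** In a local trivialisation the action is multiplication on the U(1)-component, where it
    cancels. *)
Lemma u1_act_inj (p : P) z w : act p z = act p w -> z = w.
Proof.
case: Pb => _ _ /(_ (proj p))[A [Ao Ap [psi [[_ [g _ [gK Kg]]] psip psia]]]].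
have [[a z0] pE] : exists az, p = val (psi az).
  by exists (g (@mkS _ _ (proj (u := P) @^-1` A) p Ap)); rewrite Kg.
by rewrite pE -!psia => /val_inj/(can_inj gK)/(congr1 snd)/u1_mulI.
Qed.

Lemma u1_act_trans (p q : P) : proj p = proj q -> exists z, q = act p z.
Proof.
case: Pb => _ _ /(_ (proj p))[A [Ao Ap [psi [[_ [g _ [gK Kg]]] psip psia]]]] pq.
have ex (r : P) : A (proj r) -> exists az, r = val (psi az).
  by move=> Ar; exists (g (@mkS _ _ (proj (u := P) @^-1` A) r Ar)); rewrite Kg.
have [[a z] pE] := ex p Ap; have [|[b w] qE] := ex q; first by rewrite -pq.
exists (u1_mul (u1_inv z) w); rewrite pE -psia u1_mulVK qE.
congr (val (psi (_, _))); apply: val_inj.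
by rewrite -(psip a z) -(psip b w) -pE -qE.
Qed.

Lemma u1_divP (p q : P) : proj p = proj q -> q = act p (u1_div p q).
Proof.
move=> /u1_act_trans pq; rewrite /u1_div; case: pselect => // e.
by case: cid.
Qed.

Lemma u1_divE (p q : P) z : q = act p z -> u1_div p q = z.
Proof.
move=> qE; apply: (@u1_act_inj p); rewrite -u1_divP ?qE ?proj_act //.
Qed.

Lemma u1_div_act (p q : P) z w : proj p = proj q ->
  u1_div (act p w) (act q z) = u1_mul (u1_div p q) (u1_mul z (u1_inv w)).
Proof.
move=> pq; apply: u1_divE; rewrite {1}(u1_divP pq) !actM; congr act; rewrite [RHS]u1_mulC.
by rewrite u1_mulA -[RHS]u1_mulA [u1_mul (u1_inv w) w]u1_mulC u1_mulV u1_mul1.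
Qed.

Lemma u1_proj_smooth : smooth (proj (u := P)). Proof. by case: Pb. Qed.

Lemma u1_act_smooth : smooth_act P. Proof. by case: Pb. Qed.

(** Both points lie over the same base point, so one local trivialisation covers both; there the
    quotient is that of the U(1)-components. *)
Lemma u1_div_smooth :
  smooth (fun w : subS (@fib2 X P) => u1_div (val w).1 (val w).2 : U1).
Proof.
move=> n U w wU; have Uo := plot_open wU; have [w1 w2] := wU.
apply: plot_local => // u Uu.
case: Pb => projs _ /(_ (proj (val (w u)).1))[A [Ao Au
  [psi [[_ [g gs [gK Kg]]] psip psia]]]].
have Vo : open (U `&` (fun x => proj (val (w x)).1) @^-1` A) := Ao _ _ _ (projs _ _ _ w1).
set V := _ `&` _ in Vo.
have Vu : V u by [].
have VU : V `<=` U by move=> v [].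
have [|p pV pE] := splot_sub (A := proj (u := P) @^-1` A) Vu (splotS Vo VU w1).
  by move=> x [].
have [|q qV qE] := splot_sub (A := proj (u := P) @^-1` A) Vu (splotS Vo VU w2).
  by move=> x [_]; rewrite /preimage /= -(set_valP (w x) : proj _ = proj _).
exists V, (fun x => u1_mul (u1_inv (g (p x)).2) (g (q x)).2); split=> //.
  apply: (@smooth_u1_mul R n V (fun x => (u1_inv (g (p x)).2, (g (q x)).2))).
  have [_ gp] := gs _ _ _ pV; have [_ gq] := gs _ _ _ qV.
  by split=> //; exact: (smooth_u1_inv gp).
move=> v Vv; have pv : val (p v) = (val (w v)).1 := pE v Vv.
have qv : val (q v) = (val (w v)).2 := qE v Vv.
apply: u1_divE; rewrite -pv -qv.
have pE' : p v = psi ((g (p v)).1, (g (p v)).2) by rewrite -surjective_pairing Kg.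
have qE' : q v = psi ((g (q v)).1, (g (q v)).2) by rewrite -surjective_pairing Kg.
rewrite {1}pE' -psia u1_mulVK {1}qE'; congr (val (psi (_, _))).
apply: val_inj; rewrite -(psip (g (p v)).1 (g (p v)).2).
rewrite -(psip (g (q v)).1 (g (q v)).2) -pE' -qE'.
by rewrite pv qv -(set_valP (w v) : proj _ = proj _).
Qed.

(** A local trivialisation evaluated at 1 is a smooth local section. *)
Lemma u1_proj_subduction : subduction (proj (u := P)).
Proof.
split=> [|n U q u qU Uu]; first exact: u1_proj_smooth.
case: Pb => projs _ /(_ (q u))[A [Ao Au [psi [[psis _] psip psia]]]].
have Vo := Ao _ _ _ qU; set V := _ `&` _ in Vo.
have Vu : V u by [].
have VU : V `<=` U by move=> v [].
have [|a aV aE] := splot_sub (A := A) Vu (splotS Vo VU qU); first by move=> x [].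
exists V, (fun x => val (psi (a x, u1_one))); split=> // [|v Vv].
  by apply: (psis n V (fun x => (a x, u1_one))); split=> //; exact: plot_cst.
by rewrite psip aE.
Qed.

Lemma u1_proj_surj x : exists p : P, proj p = x.
Proof.
case: Pb => _ _ /(_ x)[A [_ Ax [psi [_ psip _]]]].
by exists (val (psi (mkS Ax, u1_one))); rewrite psip.
Qed.

End U1Bundle.

Lemma trivial_u1_bundle X : is_u1_bundle (trivial X).
Proof.
have as_ : smooth_act (trivial X).
  apply: smooth_pair.
    exact: smooth_comp (@smooth_fst _ _ _) (@smooth_fst _ _ _).
  apply: (smooth_comp (g := fun zw : prodS U1 U1 => u1_mul zw.1 zw.2 : U1)
    (f := fun pz : prodS (trivial X) U1 => (pz.1.2, pz.2) : prodS U1 U1));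
    last exact: smooth_u1_mul.
  apply: smooth_pair; last exact: smooth_snd.
  exact: smooth_comp (@smooth_fst _ _ _) (@smooth_snd _ _ _).
split=> // [|x]; first exact: smooth_fst.
exists setT; split=> //; first by move=> n U p /plot_open; rewrite setIT.
pose psi (az : prodS (subS [set: X]) U1) : subS (proj (u := trivial X) @^-1` setT) :=
  @mkS _ (trivial X) (proj (u := trivial X) @^-1` setT) (val az.1, az.2) I.
exists psi; split=> //; split.
  apply: smooth_sub; apply: smooth_pair; last exact: smooth_snd.
  exact: smooth_comp (@smooth_fst _ _ _) (@smooth_val _ _ _).
pose gam (p : subS (proj (u := trivial X) @^-1` setT)) : prodS (subS [set: X]) U1 :=
  (@mkS _ _ [set: X] (val p).1 I, (val p).2).
exists gam.
  apply: smooth_pair; last exact: smooth_comp (@smooth_val _ _ _) (@smooth_snd _ _ _).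
  by apply: smooth_sub; exact: smooth_comp (@smooth_val _ _ _) (@smooth_fst _ _ _).
split=> [[a z]|[[a z] h]]; first by congr pair; exact: val_inj.
exact: val_inj.
Qed.

End Bundles.

(** * Tensor products and global frames *)

Section Tensors.
Context {R : realType}.
Local Open Scope ring_scope.
Implicit Types X Y : dspace R.

Lemma smooth_act_pullback X Y (f : X -> Y) (Q : u1_space Y) :
  smooth_act Q -> smooth_act (pullback f Q).
Proof.
move=> Qs; apply: smooth_sub; apply: smooth_pair.
  apply: smooth_comp (smooth_comp (@smooth_fst _ _ _) (@smooth_val _ _ _)) _.
  exact: smooth_fst.
apply: (smooth_comp (g := fun pz : prodS Q U1 => act pz.1 pz.2 : Q)
  (f := fun pz : prodS (pullback f Q) U1 => ((val pz.1).2, pz.2) : prodS Q U1)) Qs.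
apply: smooth_pair; last exact: smooth_snd.
apply: smooth_comp (smooth_comp (@smooth_fst _ _ _) (@smooth_val _ _ _)) _.
exact: smooth_snd.
Qed.

Lemma smooth_act_tpow X b (Q : u1_space X) : smooth_act Q -> smooth_act (tpow b Q).
Proof.
case: b => // Qs.
apply: (smooth_comp (g := fun pz : prodS Q U1 => act pz.1 pz.2 : Q)
  (f := fun pz : prodS Q U1 => (pz.1, u1_inv pz.2) : prodS Q U1)) Qs.
apply: smooth_pair; first exact: smooth_fst.
exact: smooth_comp (@smooth_snd _ _ _) smooth_u1_inv.
Qed.

(** Smoothness is tested on tuples times U(1), since a subduction remains one after a product with
    U(1). On tuples the scalar acts through factor 0. *)
Lemma smooth_act_tensor X n (Q : 'I_n.+1 -> u1_space X) :
  (forall i, smooth_act (Q i)) -> smooth_act (tensor Q).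
Proof.
move=> Qs; apply: smooth_desc (subduction_prod U1 (subduction_cls (@tens_rel _ _ _ Q))) _.
have -> : (fun w : prodS (subS (tens_set (Q := Q))) U1 =>
    act (cls (@tens_rel _ _ _ Q) w.1 : tensor Q) w.2) =
    fun w => cls (@tens_rel _ _ _ Q) (tens_pre_act w.1 w.2).
  by apply/funext => w; exact: tens_actE.
apply: (smooth_comp _ (@smooth_cls _ _ _)); apply: smooth_sub; apply: smooth_pair.
  apply: smooth_comp (smooth_comp (@smooth_fst _ _ _) (@smooth_val _ _ _)) _.
  exact: smooth_fst.
have es i : smooth (fun w : prodS (subS (tens_set (Q := Q))) U1 => (val w.1).2 i : Q i).
  by move=> m U p [[_ [_ pU]] _]; exact: pU.
apply: smooth_pi => i; case: (i == ord0); last exact: es.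
apply: (smooth_comp (g := fun pz : prodS (Q i) U1 => act pz.1 pz.2 : Q i)
  (f := fun w : prodS (subS (tens_set (Q := Q))) U1 =>
    ((val w.1).2 i, w.2) : prodS (Q i) U1)) (Qs i).
by apply: smooth_pair => //; exact: smooth_snd.
Qed.

Lemma smooth_proj_tensor X n (Q : 'I_n.+1 -> u1_space X) :
  smooth (proj (u := tensor Q)).
Proof.
apply: smooth_desc (subduction_cls (@tens_rel _ _ _ Q)) _.
have -> : (fun x => proj (cls (@tens_rel _ _ _ Q) x : tensor Q)) = fun x => (val x).1.
  by apply/funext => x; exact: tens_projE.
exact: smooth_comp (@smooth_val _ _ _) (@smooth_fst _ _ _).
Qed.

Variables (X' X : dspace R) (n : nat) (f : 'I_n.+1 -> X' -> X) (Q : u1_space X).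

Lemma smooth_act_alt : smooth_act Q -> smooth_act (alt_tensor f Q).
Proof.
by move=> Qs; apply: smooth_act_tensor => i; apply/smooth_act_tpow/smooth_act_pullback.
Qed.

Lemma smooth_alt_elt (Z : dspace R) (x : Z -> X') (q : Z -> 'I_n.+1 -> Q)
    (h : forall z i, f i (x z) = proj (q z i)) :
  smooth x -> (forall i, smooth (fun z => q z i)) ->
  smooth (fun z => alt_elt (h z) : alt_tensor f Q).
Proof.
move=> xs qs; apply: (smooth_comp _ (@smooth_cls _ _ _)).
apply: smooth_sub; apply: smooth_pair => //.
by apply: smooth_pi => i; apply: smooth_sub; exact: smooth_pair.
Qed.

(** Classes are represented by tuples, so identities on the tensor bundle may be checked on pure
    tensors. *)
Lemma alt_elt_surj (C : alt_tensor f Q) :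
  exists (q : 'I_n.+1 -> Q) (h : forall i, f i (proj C) = proj (q i)), C = alt_elt h.
Proof.
have [[[x q] qh] <-] := cls_surj C.
have pE : proj (cls (@tens_rel _ _ _ (fun i => tpow (odd i) (pullback (f i) Q)))
   (SigSub qh) : alt_tensor f Q) = x by exact: tens_projE.
have qx i : (val (q i)).1 = x by exact: set_mem qh i.
have h i : f i x = proj (val (q i)).2 by rewrite -(qx i); exact: set_valP (q i).
exists (fun i => (val (q i)).2).
have h' i : f i (proj (cls (@tens_rel _ _ _ (fun i => tpow (odd i) (pullback (f i) Q)))
   (SigSub qh) : alt_tensor f Q)) = proj (val (q i)).2 by rewrite pE.
exists h'; move: h'; rewrite pE => h'.
congr cls; apply: val_inj => /=; congr pair.
apply: functional_extensionality_dep => i; apply: val_inj => /=.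
by rewrite -(qx i) -surjective_pairing.
Qed.

Lemma alt_elt_congr x (q q' : 'I_n.+1 -> Q) (z : 'I_n.+1 -> U1)
    (h : forall i, f i x = proj (q i)) (h' : forall i, f i x = proj (q' i)) :
  \prod_i (val (z i) : R[i]) = 1 ->
  (forall i, q' i = act (q i) (if odd i then u1_inv (z i) else z i)) ->
  alt_elt h = alt_elt h'.
Proof.
move=> z1 qq'; apply: cls_eq; exists z; split=> // i.
by apply: val_inj; rewrite /= qq'.
Qed.

End Tensors.

(** * U(1)-coordinates on a tensor product of two factors *)

Section TwoFactors.
Context {R : realType}.
Local Open Scope ring_scope.
Variables (X' X : dspace R) (f : 'I_2 -> X' -> X) (Q : u1_space X).
Hypothesis Qtrans : forall p q : Q, proj p = proj q -> exists z, q = act p z.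
Variable c : X' -> Q -> Q -> U1 (R := R).
Hypothesis c_act : forall x p q z w, f ord0 x = proj p -> f ord_max x = proj q ->
  c x (act p z) (act q w) = u1_mul (c x p q) (u1_mul z (u1_inv w)).

Definition alt2_dom : set (prodS X' (prodS Q Q)) :=
  [set w | f ord0 w.1 = proj w.2.1 /\ f ord_max w.1 = proj w.2.2].

Local Notation pre :=
  (subS (tens_set (Q := fun i : 'I_2 => tpow (odd i) (pullback (f i) Q)))).
Local Notation pre_rel :=
  (@tens_rel _ _ _ (fun i : 'I_2 => tpow (odd i) (pullback (f i) Q))).

Definition alt2_elt (a : pre) i : Q :=
  (val ((val a).2 i : subS (pull_set (Q := Q) (f i)))).2.

Lemma alt2_elt_proj (a : pre) i : f i (val a).1 = proj (alt2_elt a i).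
Proof. by rewrite -(set_valP a i); exact: set_valP ((val a).2 i). Qed.

(** The value of [c] on p (x) q^*; its homogeneity makes it independent of the representative. Both
    [deltaY] and [delta_gbun] have this two-factor shape. *)
Definition alt2_coord (C : alt_tensor f Q) : U1 :=
  qlift (r := pre_rel)
    (fun a : pre => c (val a).1 (alt2_elt a ord0) (alt2_elt a ord_max)) C.

Lemma alt2_coord_cls (a : pre) : alt2_coord (cls pre_rel a) =
  c (val a).1 (alt2_elt a ord0) (alt2_elt a ord_max).
Proof.
apply: (qliftE (f := fun a : pre => c (val a).1 (alt2_elt a ord0) (alt2_elt a ord_max))).
move=> {}a b [z [z1 ab1 ab2]]; rewrite ab1.
rewrite /alt2_elt !ab2 /= c_act; try exact: alt2_elt_proj.
(* Factor 1 is dual, so its scalar is inverted by the action and once more by [c_act]: the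
   coordinate is multiplied by the product of the two scalars, which is 1. *)
rewrite u1_invK -[LHS]u1_mul1; congr u1_mul; apply: val_inj => /=.
by rewrite -[LHS]z1 big_ord_recl big_ord1; congr (_ * val (z _)); exact: val_inj.
Qed.

Lemma alt2_coordE x (q : 'I_2 -> Q) (h : forall i, f i x = proj (q i)) :
  alt2_coord (alt_elt h) = c x (q ord0) (q ord_max).
Proof. exact: alt2_coord_cls. Qed.

Lemma alt2_coord_act C z : alt2_coord (act C z) = u1_mul (alt2_coord C) z.
Proof.
have [q [h ->]] := alt_elt_surj C.
rewrite alt_elt_act !alt2_coordE /= -[q ord_max]act1 c_act //.
by rewrite act1 u1_inv1 u1_mul1.
Qed.

(** By transitivity the second tensor is (q0 z0) (x) (q1 z1)^*. Equal coordinates force z0 / z1 = 1,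
    which is the relation defining the tensor product. *)
Lemma alt2_coord_inj C D : proj C = proj D -> alt2_coord C = alt2_coord D -> C = D.
Proof.
have [q [h ->]] := alt_elt_surj C; have [q' [h' ->]] := alt_elt_surj D.
rewrite !proj_alt_elt => CD; case: _ / CD in h' *.
rewrite !alt2_coordE.
have [z0 z0E] : exists z, q' ord0 = act (q ord0) z by apply: Qtrans; rewrite -h -h'.
have [z1 z1E] : exists z, q' ord_max = act (q ord_max) z by apply: Qtrans; rewrite -h -h'.
rewrite z0E z1E c_act // -{1}[c _ _ _]u1_mul1 => /u1_mulI z01.
apply: (@alt_elt_congr _ _ _ _ _ _ _ _ _
  (fun i : 'I_2 => if i == ord0 then z0 else u1_inv z1)).
  by rewrite big_ord_recl big_ord1 /= -[LHS]/(val (u1_mul z0 (u1_inv z1)) : R[i]) -z01.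
move=> i; case: (unliftP ord0 i) => [j ->|->] //.
by rewrite (ord1 j) (_ : lift ord0 0 = ord_max) ?z1E /= ?u1_invK //; exact: val_inj.
Qed.

Lemma alt2_coord_smooth :
  smooth (fun w : subS alt2_dom => c (val w).1 (val w).2.1 (val w).2.2 : U1) ->
  smooth (alt2_coord : alt_tensor f Q -> U1).
Proof.
move=> cs; apply: smooth_desc (subduction_cls _) _.
pose g (a : pre) : subS alt2_dom := @mkS _ _ alt2_dom
  ((val a).1, (alt2_elt a ord0, alt2_elt a ord_max))
    (conj (alt2_elt_proj a ord0) (alt2_elt_proj a ord_max)).
have -> : (fun x : pre => alt2_coord (cls pre_rel x)) =
    fun x => c (val (g x)).1 (val (g x)).2.1 (val (g x)).2.2.
  by apply/funext => a; exact: alt2_coord_cls.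
apply: smooth_comp cs; apply: smooth_sub.
have es i : smooth (fun a : pre => alt2_elt a i : Q).
  by move=> m U p [_ [_ pU]]; exact: (pU i).2.
apply: smooth_pair; first exact: smooth_comp (@smooth_val _ _ _) (@smooth_fst _ _ _).
exact: smooth_pair.
Qed.

End TwoFactors.

Section Frames.
Context {R : realType}.
Local Open Scope ring_scope.
Variable X : dspace R.

(* A frame amounts to an isomorphism of [P] with the trivial bundle. *)
Definition is_frame (P : u1_space X) (e : X -> P) (c : P -> U1 (R := R)) :=
  [/\ smooth e /\ smooth c, forall x, proj (e x) = x, forall x, c (e x) = u1_one,
      forall p z, c (act p z) = u1_mul (c p) z &
      forall p q, proj p = proj q -> c p = c q -> p = q].

(** The map keeps base point and coordinate, which determine an element. It and its inverse are
    given by the same formula, the frame at the base point acted on by the coordinate, and are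
    smooth as composites. *)
Lemma frame_iso (P Q : u1_space X) (e : X -> P) (c : P -> U1) (e' : X -> Q) (c' : Q -> U1) :
  smooth (proj (u := P)) -> smooth (proj (u := Q)) -> smooth_act P -> smooth_act Q ->
  is_frame e c -> is_frame e' c' ->
  exists phi : u1_map P Q, is_u1_iso phi /\ forall x, phi (e x) = e' x.
Proof.
move=> Pp Qp Pa Qa [[es cs] pe ce ca ci] [[es' cs'] pe' ce' ca' ci'].
pose F p := act (e' (proj p)) (c p); pose G q := act (e (proj q)) (c' q).
have pF p : proj (F p) = proj p by rewrite proj_act pe'.
have pG q : proj (G q) = proj q by rewrite proj_act pe.
have cF p : c' (F p) = c p by rewrite ca' ce' u1_mul1l.
have cG q : c (G q) = c' q by rewrite ca ce u1_mul1l.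
have aF p z : F (act p z) = act (F p) z.
  by apply: ci'; rewrite ?proj_act ?pF ?proj_act // ca' !cF ca.
exists (U1Map pF aF); split; last first.
  by move=> x; apply: ci'; rewrite /= ?pF ?pe ?pe' // cF ce ce'.
have Fs : smooth F.
  apply: (smooth_comp (g := fun pz : prodS Q U1 => act pz.1 pz.2 : Q)
    (f := fun p : P => (e' (proj p), c p) : prodS Q U1)) Qa.
  by apply: smooth_pair => //; exact: smooth_comp es'.
have Gs : smooth G.
  apply: (smooth_comp (g := fun pz : prodS P U1 => act pz.1 pz.2 : P)
    (f := fun q : Q => (e (proj q), c' q) : prodS P U1)) Pa.
  by apply: smooth_pair => //; exact: smooth_comp es.
split=> //; exists G => //; split=> [p|q]; first by apply: ci; rewrite ?pG ?pF // cG cF.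
by apply: ci'; rewrite /= ?pF ?pG // cF cG.
Qed.

End Frames.

(** * The simplicial manifold EG(X) *)

Section EG.
Context {R : realType} (G : groupType) (DG : diffeology R G).
Hypothesis hG : is_lie_group DG.

Lemma smooth_mulg :
  smooth (fun gh : prodS (groupS DG) (groupS DG) => (gh.1 * gh.2)%g : groupS DG).
Proof. by case: hG. Qed.

Section Action.
Variables (X : dspace R) (a : X -> G -> X).
Hypothesis ha : is_smooth_action DG a.

Local Notation lev := (EG_level DG X).
Local Notation fc n i := (@EG_face R G DG X a n i).
Local Notation dg n i := (@EG_degen R G DG X n i).

(** The recursion peels off the last group element: the last face drops it, the one before
    multiplies it into its neighbour (from level 2 on), the others leave it alone. These three rules
    carry the simplicial identities by induction on the level. *)
Lemma EG_face_last n (w : lev n.+1) : fc n n.+1 w = w.1.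
Proof. by case: n w => [|n] w //=; rewrite eqxx. Qed.

Lemma EG_face_mul n (w : lev n.+2) : fc n.+1 n.+1 w = (w.1.1, (w.1.2 * w.2)%g).
Proof. by rewrite /= eqxx ltn_eqF. Qed.

Lemma EG_face_rec n i (w : lev n.+2) : (i <= n)%N -> fc n.+1 i w = (fc n i w.1, w.2).
Proof. by move=> le_in; rewrite /= !ltn_eqF // ltnW. Qed.

Lemma EG_degen_last n (w : lev n) : dg n n w = (w, 1%g).
Proof. by case: n w => [|n] w //=; rewrite eqxx. Qed.

Lemma EG_degen_rec n i (w : lev n.+1) : (i <= n)%N -> dg n.+1 i w = (dg n i w.1, w.2).
Proof. by move=> le_in; rewrite /= ltn_eqF. Qed.

Lemma EG_face_face n i j (x : lev n.+2) : (i <= j)%N -> (j <= n.+1)%N ->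
  fc n i (fc n.+1 j.+1 x) = fc n j (fc n.+1 i x).
Proof.
have [_ _ aM] := ha.
elim: n i j x => [|n IH] i j x ij; rewrite leq_eqVlt => /predU1P[jn|].
- subst j; rewrite !EG_face_last.
  by move: ij; rewrite leq_eqVlt => /predU1P[->|i0];
    rewrite ?EG_face_mul ?EG_face_last // EG_face_rec.
- rewrite ltnS leqn0 => /eqP j0; subst j; move: ij; rewrite leqn0 => /eqP ->.
  (* Level 2 with i = j = 0: this is the action law. *)
  by rewrite EG_face_mul EG_face_rec //= aM.
- subst j; rewrite !EG_face_last.
  by move: ij; rewrite leq_eqVlt => /predU1P[->|i0];
    rewrite ?EG_face_mul ?EG_face_last // [fc n.+2 i x]EG_face_rec.
- rewrite ltnS leq_eqVlt => /predU1P[jn|jn].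
    subst j; rewrite EG_face_mul; move: ij; rewrite leq_eqVlt => /predU1P[->|i0].
      (* Two successive products at the end of the tuple: associativity in G. *)
      by rewrite [fc n.+2 n.+1 x]EG_face_rec // !EG_face_mul /= mulgA.
    by rewrite [fc n.+2 i x]EG_face_rec ?(ltnW i0) // EG_face_mul !EG_face_rec.
  have in_ : (i <= n)%N by apply: leq_trans ij _.
  rewrite [fc n.+2 _ _]EG_face_rec // [fc n.+2 _ _]EG_face_rec; last exact: leqW.
  by rewrite [LHS]EG_face_rec // [RHS]EG_face_rec // IH // leqW.
Qed.

Lemma EG_degen_degen n i j (x : lev n) : (i <= j)%N -> (j <= n)%N ->
  dg n.+1 i (dg n j x) = dg n.+1 j.+1 (dg n i x).
Proof.
elim: n i j x => [|n IH] i j x ij; rewrite leq_eqVlt => /predU1P[jn|//].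
- by subst j; rewrite !EG_degen_last EG_degen_rec.
- by subst j; rewrite !EG_degen_last EG_degen_rec.
rewrite ltnS => jn; have in_ : (i <= n)%N by apply: leq_trans ij _.
rewrite (EG_degen_rec _ jn) (EG_degen_rec _ in_).
by rewrite [LHS]EG_degen_rec ?leqW // [RHS]EG_degen_rec // IH.
Qed.

Lemma EG_face_degen_lt n i j (x : lev n.+1) : (i <= j)%N -> (j <= n)%N ->
  fc n.+1 i (dg n.+1 j.+1 x) = dg n j (fc n i x).
Proof.
elim: n i j x => [|n IH] i j x ij; rewrite leq_eqVlt => /predU1P[jn|//].
- by subst j; rewrite !EG_degen_last EG_face_rec.
- by subst j; rewrite !EG_degen_last EG_face_rec.
rewrite ltnS => jn; have in_ : (i <= n)%N by apply: leq_trans ij _.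
rewrite EG_degen_rec // EG_face_rec; last exact: leqW.
by rewrite IH // (EG_face_rec x in_) [RHS]EG_degen_rec.
Qed.

(** The inserted 1 is multiplied onto g_i from the right, or acts on the point when i = 0. *)
Lemma EG_face_degen n i (x : lev n) : (i <= n)%N -> fc n i (dg n i x) = x.
Proof.
have [_ a1 _] := ha.
elim: n i x => [|n IH] i x; first by rewrite leqn0 => /eqP ->; rewrite /= a1.
rewrite leq_eqVlt => /predU1P[->|ilt].
  by rewrite EG_degen_last EG_face_mul /= mulg1 -surjective_pairing.
by rewrite EG_degen_rec // EG_face_rec //= IH // -surjective_pairing.
Qed.

Lemma EG_faceS_degen n i (x : lev n) : (i <= n)%N -> fc n i.+1 (dg n i x) = x.
Proof.
elim: n i x => [|n IH] i x; first by rewrite leqn0 => /eqP ->.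
rewrite leq_eqVlt => /predU1P[->|ilt]; first by rewrite EG_degen_last EG_face_last.
rewrite EG_degen_rec //; move: ilt; rewrite ltnS leq_eqVlt => /predU1P[->|ilt].
  by rewrite EG_degen_last EG_face_mul /= mul1g -surjective_pairing.
by rewrite EG_face_rec //= IH ?(ltnW ilt) // -surjective_pairing.
Qed.

Lemma EG_face_degen_gt n i j (x : lev n.+1) : (j < i)%N -> (i <= n.+1)%N ->
  fc n.+1 i.+1 (dg n.+1 j x) = dg n j (fc n i x).
Proof.
elim: n i j x => [|n IH] i j x ji; rewrite leq_eqVlt => /predU1P[in_|].
- by subst i; rewrite EG_face_last EG_degen_rec // EG_face_last.
- by rewrite ltnS leqn0 => /eqP i0; rewrite i0 in ji.
- by subst i; rewrite EG_face_last EG_degen_rec // EG_face_last.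
rewrite ltnS leq_eqVlt => /predU1P[in_|in_].
  subst i; rewrite EG_degen_rec; last exact: leqW.
  by rewrite !EG_face_mul [dg n.+1 j x.1]EG_degen_rec // [RHS]EG_degen_rec.
have jn : (j <= n)%N by apply: leq_trans (ltnW ji) _.
rewrite EG_degen_rec; last exact: leqW.
by rewrite [LHS]EG_face_rec // (EG_face_rec x in_) [RHS]EG_degen_rec // IH // leqW.
Qed.

Lemma smooth_EG_face n i : smooth (fc n i).
Proof.
have [as_ _ _] := ha.
elim: n i => [|n IH] i /=; first by case: eqP => // _; exact: smooth_fst.
case: eqP => _; first exact: smooth_fst.
case: eqP => _; last first.
  apply: smooth_pair; last exact: smooth_snd.
  exact: smooth_comp (@smooth_fst _ _ _) (IH i).
move=> m U p [[p1 p2] p3]; split=> //.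
by apply: (@smooth_mulg m U (fun x => ((p x).1.2, (p x).2))).
Qed.

Lemma smooth_EG_degen n i : smooth (dg n i).
Proof.
elim: n i => [|n IH] i /=.
  by apply: smooth_pair; [exact: smooth_id|exact: smooth_cst].
case: eqP => _; first by apply: smooth_pair; [exact: smooth_id|exact: smooth_cst].
apply: smooth_pair; last exact: smooth_snd.
exact: smooth_comp (@smooth_fst _ _ _) (IH i).
Qed.

Lemma EG_simplicial_manifold : is_manifold X -> is_simplicial_manifold (EG DG a).
Proof.
move=> hX; split.
- by elim=> //= n IH; apply: is_manifold_prod => //; case: hG.
- by split=> n i; [exact: smooth_EG_face|exact: smooth_EG_degen].
- by move=> n i j x ij; exact: (EG_face_face x ij (ltn_ord j)).
- by move=> n i j x ij; exact: (EG_degen_degen x ij (ltn_ord j)).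
split.
- by move=> n i j x ij; exact: (EG_face_degen_lt x ij (ltn_ord j)).
- by move=> n i x; exact: (EG_face_degen x (ltn_ord i)).
- by move=> n i x; exact: (EG_faceS_degen x (ltn_ord i)).
- by move=> n i j x ji; exact: (EG_face_degen_gt x ji (ltn_ord i)).
Qed.

End Action.
End EG.

(** * The trivialisation induced by a strong action *)

Section Strong.
Context {R : realType} (G : groupType) (DG : diffeology R G).
Variables (M : dspace R) (aM : M -> G -> M) (Y : dspace R) (pi : Y -> M) (Gb : gerbe pi).
Hypothesis hGb : is_bundle_gerbe Gb.
Variable sa : strong_action DG aM Gb.

Local Notation P := (gbun Gb).
Local Notation piS := (ind_pi sa).
Local Notation B := (sq_simp piS 1).
Local Notation DT := (deltaY (piS 1%N) (ind_T sa)).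
Local Notation DP := (delta_gbun (ind_gerbe sa)).

Let Pb : is_u1_bundle P. Proof. by case: hGb => [[]]. Qed.

Lemma translate_base_subproof (p : P) (g : G) :
  sq_set (piS 1%N) (((val (proj p)).1, g), ((val (proj p)).2, g)).
Proof. by congr pair; exact: (set_valP (proj p)). Qed.

(** Two points of EG(Y)_1 over the same point of EG(M)_1 carry the same group element, so pairs (p,
    g) reach the whole fibre square. *)
Definition translate_base (p : P) (g : G) : B := mkS (translate_base_subproof p g).

Lemma translate_face p g (i : 'I_2) :
  face i (translate_base p g) = proj (if i == ord0 then sa_P sa p g else p).
Proof.
apply: val_inj; case: i => [[|[|//]] ilt] /=; first by rewrite sa_P_proj.
by rewrite -surjective_pairing.
Qed.

(* (p g) (x) p^* *)
Definition translate (p : P) (g : G) : DP := alt_elt (translate_face p g).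

(** The scalars contributed by p g and by p^* are inverse to each other. *)
Lemma translate_act p z g : translate (act p z) g = translate p g.
Proof.
rewrite /translate.
have E : translate_base (act p z) g = translate_base p g.
  by apply: val_inj; rewrite /= !proj_act.
have h i : face i (translate_base p g) =
    proj (if i == ord0 then sa_P sa (act p z) g else act p z).
  by rewrite -E; exact: translate_face.
have -> : alt_elt (translate_face (act p z) g) = alt_elt h.
  by move: (translate_face (act p z) g); rewrite E => h'; exact: alt_elt_eq.
apply/esym; apply: (@alt_elt_congr _ _ _ _ _ _ _ _ _
  (fun i : 'I_2 => if i == ord0 then z else u1_inv z)).
  by rewrite big_ord_recl big_ord1 eqxx; exact: u1_val_mulV.
move=> i; case: (unliftP ord0 i) => [j ->|->] /=; last by rewrite sa_P_act.
by rewrite (ord1 j) /= u1_invK.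
Qed.

Lemma translate_base_inj p g p' g' :
  translate_base p g = translate_base p' g' -> proj p = proj p' /\ g = g'.
Proof.
move=> /(congr1 val) /= [y1 gg y2]; split=> //; apply: val_inj.
by rewrite [LHS]surjective_pairing [RHS]surjective_pairing y1 y2.
Qed.

Lemma translate_base_eq p g p' g' :
  translate_base p g = translate_base p' g' -> translate p g = translate p' g'.
Proof.
move=> /translate_base_inj[/(u1_act_trans Pb)[z ->] ->].
by rewrite translate_act.
Qed.

(** The fibre square is Y^[2] times G, and under this identification the map is the projection of P
    times the identity. *)
Lemma translate_base_subduction :
  subduction (fun pg : prodS P (groupS DG) => translate_base pg.1 pg.2 : B).
Proof.
have bs (x : B) : sq_set pi ((val x).1.1, (val x).2.1).
  by have := set_valP x; case.
pose b (x : B) : prodS (sq pi) (groupS DG) := (mkS (bs x), (val x).1.2).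
have bsm : smooth b.
  apply: smooth_pair; last by move=> n U p [[]].
  by apply: smooth_sub; move=> n U p [[p1 _] [p2 _]].
split.
  apply: smooth_sub => n U p [p1 p2].
  by have [q1 q2] := u1_proj_smooth Pb p1.
move=> n U q u qU Uu.
have [_ lift] := subduction_prod (groupS DG) (u1_proj_subduction Pb).
have [V [p [Vu VU pV pE]]] := lift _ _ _ _ (bsm _ _ _ qU) Uu.
exists V, p; split=> // v /pE; rewrite /b => -[pq1 pq2].
apply: val_inj; rewrite /= pq2 pq1 /=.
have /= := set_valP (q v); case: (val (q v)) => -[y1 g1] [y2 g2] /= [_ ->].
by [].
Qed.

Lemma translate_base_surj (x : B) : exists pg, translate_base pg.1 pg.2 = x.
Proof.
have bx : sq_set pi ((val x).1.1, (val x).2.1) by have := set_valP x; case.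
have [p pE] := u1_proj_surj Pb (mkS bx).
exists (p, (val x).1.2); apply: val_inj; rewrite /= pE /=.
have /= := set_valP x; case: (val x) => -[y1 g1] [y2 g2] /= [_ ->].
by [].
Qed.

(** The chosen representative is immaterial by [translate_base_eq]; smoothness is then checked on
    pairs (p, g). *)
Definition translate_sec (x : B) : DP :=
  let pg := projT1 (cid (translate_base_surj x)) in translate pg.1 pg.2.

Lemma translate_secE p g : translate_sec (translate_base p g) = translate p g.
Proof. rewrite /translate_sec; case: cid => pg H; exact: translate_base_eq H. Qed.

Lemma sa_P_smooth : smooth (fun pg : prodS P (groupS DG) => sa_P sa pg.1 pg.2 : P).
Proof. by case: (sa_P_action sa). Qed.

Lemma translate_sec_smooth : smooth translate_sec.
Proof.
apply: smooth_desc translate_base_subduction _.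
have -> : (fun x : prodS P (groupS DG) =>
    translate_sec (translate_base x.1 x.2)) = fun x => translate x.1 x.2.
  by apply/funext => x; exact: translate_secE.
apply: smooth_alt_elt; first by case: translate_base_subduction.
by move=> i; case: (i == ord0); [exact: sa_P_smooth|exact: smooth_fst].
Qed.

(** The scalar u with p = (q g) u. As G commutes with U(1), it is the u with p g^-1 = q u, that is,
    the isomorphism with U(1) given by g^-1. *)
Definition delta_fib (x : B) (p q : P) : U1 := u1_div (sa_P sa q (val x).1.2) p.

Lemma face_sa_P (x : B) (q : P) : face ord_max x = proj q ->
  proj (sa_P sa q (val x).1.2) = face ord0 x.
Proof.
move=> xq; apply: val_inj; rewrite sa_P_proj -xq /=.
by have /= := set_valP x; case: (val x) => -[y1 g1] [y2 g2] /= [_ ->].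
Qed.

Lemma delta_fib_act x p q z w : face ord0 x = proj p -> face ord_max x = proj q ->
  delta_fib x (act p z) (act q w) = u1_mul (delta_fib x p q) (u1_mul z (u1_inv w)).
Proof.
move=> xp /face_sa_P xq; rewrite /delta_fib sa_P_act u1_div_act //.
by rewrite xq.
Qed.

Lemma translate_frame : is_frame translate_sec
  (alt2_coord (f := face (s := sq_simp piS) (n := 0)) delta_fib).
Proof.
have ce p g : alt2_coord delta_fib (translate p g) = u1_one.
  rewrite alt2_coordE; last exact: delta_fib_act.
  by apply: (u1_divE Pb); rewrite /= act1.
split.
- split; first exact: translate_sec_smooth.
  apply: alt2_coord_smooth; first exact: delta_fib_act.
  apply: (smooth_comp (g := fun w : subS (@fib2 _ _ P) => u1_div (val w).1 (val w).2 : U1)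
    (f := fun w : subS (alt2_dom (Q := P) (face (s := sq_simp piS) (n := 0))) =>
      @mkS _ _ (@fib2 _ _ P) (sa_P sa (val w).2.2 (val (val w).1).1.2, (val w).2.1)
        (etrans (face_sa_P (set_valP w).2) (set_valP w).1))); last exact: u1_div_smooth Pb.
  apply: smooth_sub; apply: smooth_pair; last by move=> n U p [_ []].
  move=> n U p [[[_ p1] _] [p2 p3]].
  by apply: (@sa_P_smooth n U (fun x => ((val (p x)).2.2, (val (val (p x)).1).1.2))).
- by move=> x; have [pg <-] := translate_base_surj x; rewrite translate_secE proj_alt_elt.
- by move=> x; have [pg <-] := translate_base_surj x; rewrite translate_secE.
- by move=> C z; apply: alt2_coord_act; exact: delta_fib_act.
- by move=> C D; apply: alt2_coord_inj; [exact: u1_act_trans Pb|exact: delta_fib_act].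
Qed.

Definition one_fib (x : B) (p q : ind_T sa) : U1 := u1_mul p.2 (u1_inv q.2).

Lemma one_fib_act x p q z w :
  one_fib x (act p z) (act q w) = u1_mul (one_fib x p q) (u1_mul z (u1_inv w)).
Proof. exact: u1_mul_div. Qed.

Definition one_sec (x : B) : DT :=
  @alt_elt _ _ _ _ (fun (i : 'I_2) (y : B) => if i == ord0 then (val y).2 else (val y).1)
   (ind_T sa) x (fun i => ((if i == ord0 then (val x).2 else (val x).1), u1_one)) (fun=> erefl).

Lemma one_frame : is_frame one_sec (alt2_coord
  (f := fun (i : 'I_2) (y : B) => if i == ord0 then (val y).2 else (val y).1) one_fib).
Proof.
split.
- split.
    apply: smooth_alt_elt; first exact: smooth_id.
    move=> i; apply: smooth_pair; last exact: smooth_cst.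
    by case: (i == ord0) => n U p [].
  apply: alt2_coord_smooth; first by move=> *; exact: one_fib_act.
  move=> n U p [_ [[_ p1] [_ p2]]].
  apply: (@smooth_u1_mul R n U (fun x => ((val (p x)).2.1.2, u1_inv (val (p x)).2.2.2))).
  by split=> //; exact: (smooth_u1_inv p2).
- by move=> x; rewrite proj_alt_elt.
- move=> x; rewrite alt2_coordE /one_fib /= ?u1_mulV // => *; exact: one_fib_act.
- by move=> C z; apply: alt2_coord_act => *; exact: one_fib_act.
- move=> C D; apply: alt2_coord_inj => *; last exact: one_fib_act.
  exact: u1_act_trans (trivial_u1_bundle _) _ _ _.
Qed.

Lemma ind_iso_exists :
  exists phi : u1_map DT DP, is_u1_iso phi /\ forall x, phi (one_sec x) = translate_sec x.
Proof.
apply: frame_iso one_frame translate_frame; try exact: smooth_proj_tensor.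
  by apply: smooth_act_alt; exact: u1_act_smooth (trivial_u1_bundle _).
by apply: smooth_act_alt; exact: u1_act_smooth Pb.
Qed.

End Strong.

(** * The induced section and the weak action *)

Section WeakAction.
Context {R : realType} (G : groupType) (DG : diffeology R G).
Hypothesis hG : is_lie_group DG.
Variables (M : dspace R) (aM : M -> G -> M) (Y : dspace R) (pi : Y -> M) (Gb : gerbe pi).
Hypothesis haM : is_smooth_action DG aM.
Hypothesis hM : is_manifold M.
Hypothesis hGb : is_bundle_gerbe Gb.
Variable sa : strong_action DG aM Gb.

Local Notation P := (gbun Gb).
Local Notation piS := (ind_pi sa).
Local Notation B := (sq_simp piS 1).
Local Notation DT := (deltaY (piS 1%N) (ind_T sa)).
Local Notation DP := (delta_gbun (ind_gerbe sa)).

Let Pb : is_u1_bundle P. Proof. by case: hGb => [[]]. Qed.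

(** Each level adds a factor G on which the map is the identity. *)
Lemma EG_map_surj_submersion n : is_surj_submersion (piS n).
Proof.
elim: n => [|n IH]; first by case: hGb => [[]].
by apply: is_surj_submersion_prod IH _; case: hG.
Qed.

Variable phi : u1_map DT DP.
Hypothesis phiE : forall x, phi (one_sec x) = translate_sec hGb x.

(** By the frame on [deltaY], t2 (x) t1^* is the unit section times the ratio of the
    U(1)-components, and [phi] commutes with that scalar. *)
Lemma phi_deltaY_elt (t1 t2 : ind_T sa) (h : piS 1%N (proj t1) = piS 1%N (proj t2)) p g :
  translate_base sa p g = sq_elt h ->
  phi (deltaY_elt h) = act (translate sa p g) (u1_mul t2.2 (u1_inv t1.2)).
Proof.
move=> pg; rewrite -(translate_secE hGb) pg -phiE -u1_fun_act; congr (phi _).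
have [_ _ dt1 dta dti] := one_frame sa.
apply: dti; first by rewrite proj_act !proj_alt_elt.
rewrite dta dt1 u1_mul1l alt2_coordE // => *; exact: one_fib_act.
Qed.

Lemma ind_isoP : is_ind_iso phi.
Proof.
move=> p g t y; exists (translate_base_subproof sa p g).
exists (translate_base sa p g), (translate_face sa p g); split=> //.
rewrite (@phi_deltaY_elt (t y.1) (t y.2) (translate_base_subproof sa p g) p g);
  last exact: val_inj.
rewrite (_ : u1_mul _ _ = u1_one) ?act1 //; exact: u1_mulV.
Qed.

Lemma u1_ratioM (a b c : U1 (R := R)) :
  u1_mul (u1_mul b (u1_inv a)) (u1_mul c (u1_inv b)) = u1_mul c (u1_inv a).
Proof.
by rewrite [u1_mul b _]u1_mulC -u1_mulA [u1_mul c _]u1_mulC u1_mulVK u1_mulC.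
Qed.

Lemma gmul_act (p q : P) z w (h : composable p q) (h' : composable (act p z) (act q w)) :
  gmul h' = act (gmul h) (u1_mul z w).
Proof.
have [_ _ _ gact _] := hGb.
have cact (a b : P) x y : composable a b -> composable (act a x) (act b y).
  by rewrite /composable !proj_act.
have hl : composable (act p z) q by rewrite -[q]act1; exact: cact.
have hr : composable p (act q z) by rewrite -[p]act1; exact: cact.
have hl' : composable (act (act p z) w) q by rewrite -[q]act1; exact: cact.
by rewrite (gact _ _ _ hl hl' h').2 (gact _ _ _ h hl hr).1 actM.
Qed.

(** With p over (y1, y2) and p' over (y2, y3), the product of translates is the translate of p p'
    because G respects the gerbe product; the scalars t2/t1 and t3/t2 telescope to t3/t1. *)
Lemma ind_trivialisation : is_u1_iso phi -> is_delta_trivialisation phi.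
Proof.
move=> phi_iso; split=> //; first exact: trivial_u1_bundle.
move=> t1 t2 t3 h12 h23 h13.
have [[p g] /= E12] := translate_base_surj hGb (sq_elt h12).
have [[p' g'] /= E23] := translate_base_surj hGb (sq_elt h23).
have V12 := congr1 val E12; have V23 := congr1 val E23.
(* Both are the group element of the base point of [t2]. *)
have gg' : g' = g.
  transitivity (proj t2).2; first by rewrite -(congr1 (fun v => v.1.2) V23).
  by rewrite -(congr1 (fun v => v.2.2) V12).
subst g'.
have c : composable p p'.
  transitivity (proj t2).1; first exact: (congr1 (fun v => v.2.1) V12).
  exact: esym (congr1 (fun v => v.1.1) V23).
have [_ _ gproj _ _] := hGb.
set z12 := u1_mul t2.2 (u1_inv t1.2); set z23 := u1_mul t3.2 (u1_inv t2.2).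
set z13 := u1_mul t3.2 (u1_inv t1.2).
have E13 : translate_base sa (gmul c) g = sq_elt h13.
  apply: val_inj; rewrite /= gproj /=; congr pair.
    exact: (congr1 fst V12).
  exact: (congr1 snd V23).
rewrite (phi_deltaY_elt E12) (phi_deltaY_elt E23) (phi_deltaY_elt E13) -/z12 -/z23 -/z13.
rewrite /translate !alt_elt_act.
(* The factors r g and r with the scalar absorbed in factor 0, in the exact form left by
   [alt_elt_act]. *)
pose q (r : P) (z : U1) (i : 'I_2) : P :=
  if i == ord0 then act (if i == ord0 then sa_P sa r g else r) z
  else if i == ord0 then sa_P sa r g else r.
have cg : composable (sa_P sa p g) (sa_P sa p' g).
  by rewrite /composable !sa_P_proj /= c.
have cq i : composable (q p z12 i) (q p' z23 i).
  by rewrite /q; case: (i == ord0) => //; rewrite /composable !proj_act.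
have qE i : q (gmul c) z13 i = gmul (cq i).
  move: (cq i); rewrite /q; case: (i == ord0) => cqi; last first.
    by congr gmul; exact: Prop_irrelevance.
  rewrite (gmul_act cg cqi) u1_ratioM; congr act.
  exact: esym (sa_P_mul c cg).
have hx i : face i (translate_base sa (gmul c) g) = proj (gmul (cq i)).
  by rewrite -qE; exact: (alt_elt_act_subproof z13 (translate_face sa (gmul c) g) i).
exists (translate_base sa p g), (translate_base sa p' g).
exists (translate_base sa (gmul c) g), (q p z12), (q p' z23).
exists (alt_elt_act_subproof z12 (translate_face sa p g)).
exists (alt_elt_act_subproof z23 (translate_face sa p' g)), cq, hx.
split=> //.
- by rewrite E12 E23.
- by rewrite E12 E23 E13.
- exact: alt_elt_eq.
Qed.

Definition one_elt (w : ind_Y sa 2) : delta (X := ind_Y sa) (ind_T sa) :=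
  alt_elt (x := w) (q := fun i => (face i w, u1_one) : ind_T sa) (fun=> erefl).

(** Over one point of M x G x G, [w1] and [w2] differ only in their points of Y. A single p over
    that pair of points supplies representatives for all three faces. *)
Lemma one_elt_desc (w1 w2 : ind_Y sa 2) : piS 2%N w1 = piS 2%N w2 ->
  desc_rel phi (one_elt w1) (one_elt w2).
Proof.
move=> hw.
pose t w (i : 'I_3) : ind_T sa := (face i w, u1_one).
have h12 i : piS 1%N (proj (t w1 i)) = piS 1%N (proj (t w2 i)).
  by rewrite !smap_face hw.
pose x : sq_simp piS 2%N := mkS (A := sq_set (piS 2%N)) (x := (w1, w2)) hw.
have xE i : face i x = sq_elt (h12 i) by exact: val_inj.
have hd i : face i x = proj (phi (deltaY_elt (h12 i))).
  by rewrite u1_fun_proj proj_alt_elt.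
exists w1, w2, hw, (t w1), (t w2), (fun=> erefl), (fun=> erefl), h12, hd; split=> //.
exists x, (fun i => phi (deltaY_elt (h12 i))), hd; split=> //.
have y12 : sq_set pi (w1.1.1, w2.1.1) := congr1 (fun v => v.1.1) hw.
have g12 : w2.1.2 = w1.1.2 := esym (congr1 (fun v => v.1.2) hw).
have k12 : w2.2 = w1.2 := esym (congr1 snd hw).
have [p pE] := u1_proj_surj Pb (mkS y12).
(* The faces of (y, g, k) are (y g, k), (y, g k) and (y, g): hence the elements p g, p, p in [r] and
   the group elements k, g k, g in [l]. *)
pose g := w1.1.2; pose k := w1.2.
pose r (i : 'I_3) := if i == ord0 then sa_P sa p g else p.
pose l (i : 'I_3) : G := match i : nat with 0 => k | 1 => (g * k)%g | _ => g end.
have rl i : translate_base sa (r i) (l i) = face i x.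
  apply: val_inj; case: i => [[|[|[|//]]] ilt] /=.
  - by rewrite sa_P_proj pE /= g12 k12.
  - by rewrite pE /= g12 k12.
  - by rewrite pE /=; congr pair; rewrite [RHS]surjective_pairing ?g12.
pose u i j : P := if j == ord0 :> 'I_2 then sa_P sa (r i) (l i) else r i.
have uh i j : face j (face i x) = proj (u i j) by rewrite -rl; exact: translate_face.
exists u, uh; split.
  (* The pairs with j = 1 agree as they stand; for i = j = 0 the claim is p (g k) = (p g) k. *)
  move=> [[|[|//]] ilt] [[|[|//]] jlt] //= _; rewrite /u /r /l /=.
  by have [_ _ ->] := sa_P_action sa.
move=> i; rewrite (phi_deltaY_elt (etrans (rl i) (xE i))).
rewrite (_ : u1_mul _ _ = u1_one); last exact: u1_mulV.
rewrite act1 /translate.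
move: (translate_face sa (r i) (l i)); rewrite rl => h; exact: alt_elt_eq.
Qed.

Lemma one_elt_class_proj (w : ind_Y sa 2) : proj (A_T_class phi (one_elt w)) = piS 2%N w.
Proof.
rewrite [LHS]desc_projE; last exact: desc_rel_proj.
by congr (piS 2%N _); exact: proj_alt_elt.
Qed.

Lemma ind_section_exists : exists s : u1_section (A_T phi), is_ind_section s.
Proof.
have [_ surj2] := EG_map_surj_submersion 2.
(* The lift [l] is arbitrary and carries no regularity; [one_elt_desc] makes the class independent
   of it. *)
have [l lE] := choice surj2.
pose s x : A_T phi := A_T_class phi (one_elt (l x)).
have sE w : s (piS 2%N w) = A_T_class phi (one_elt w).
  by apply: cls_eq; apply: one_elt_desc; rewrite lE.
have sp x : proj (s x) = x by rewrite one_elt_class_proj lE.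
(* Pulled back to EG(Y)_2 the section is the class of an explicit smooth map, and plots of EG(M)_2
   lift there locally. *)
have ss : smooth s.
  apply: smooth_desc (surj_submersion_subduction (EG_map_surj_submersion 2)) _.
  have -> : (fun w => s (piS 2%N w)) = fun w => A_T_class phi (one_elt w).
    by apply/funext => w; exact: sE.
  apply: (smooth_comp _ (@smooth_cls _ _ _)); apply: smooth_alt_elt; first exact: smooth_id.
  move=> i; apply: smooth_pair; last exact: smooth_cst.
  exact: (smooth_EG_face hG (sa_Y_action sa)).
by exists (U1Section ss sp) => w; exact: sE.
Qed.

Lemma ind_weak_action (s : u1_section (A_T phi)) :
  is_u1_iso phi -> is_ind_section s ->
  is_weak_action (f := piS) (Gb0 := ind_gerbe sa) s.
Proof.
move=> phi_iso sE; have mY : is_manifold Y by case: hGb => [[]].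
split.
- split; first exact: (EG_simplicial_manifold hG haM hM).
  exact: (EG_simplicial_manifold hG (sa_Y_action sa) mY).
- exact: EG_map_surj_submersion.
- exact: hGb.
- exact: ind_trivialisation.
move=> x; have [_ /(_ x)[w wx]] := EG_map_surj_submersion 3.
have fx i : face i x = piS 2%N (face i w) by rewrite -wx smap_face.
have h i : face i x = proj (A_T_class phi (one_elt (face i w))).
  by rewrite one_elt_class_proj.
exists w, (fun i => one_elt (face i w)), h; split=> //; last first.
  by apply: alt_elt_eq => i; rewrite fx sE.
(* All U(1)-components are 1, so paired factors agree as soon as their base points do, which is the
   simplicial identity for faces of EG(Y). *)
exists (fun i j => (face j (face i w), u1_one)), (fun i j => erefl); split=> // i j ij.
congr pair; exact: (EG_face_face (sa_Y_action sa) _ ij (ltn_ord j)).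
Qed.

End WeakAction.

Theorem proposition4p3 (R : realType)
  (G : groupType) (DG : diffeology R G) (hG : is_lie_group DG)
  (M : dspace R) (hM : is_manifold M)
  (aM : M -> G -> M) (haM : is_smooth_action DG aM)
  (Y : dspace R) (pi : Y -> M) (Gb : gerbe pi) (hGb : is_bundle_gerbe Gb)
  (sa : strong_action DG aM Gb) :
  exists (phi : u1_map (deltaY (ind_pi sa 1%N) (ind_T sa))
                       (delta_gbun (ind_gerbe sa)))
         (s : u1_section (A_T phi)),
    [/\ is_ind_iso phi, is_ind_section s &
        is_weak_action (f := ind_pi sa) (Gb0 := ind_gerbe sa) s].
Proof.
have [phi [phi_iso phiE]] := ind_iso_exists hGb sa.
have [s sE] := ind_section_exists hG phiE.
exists phi, s; split=> //; first exact: ind_isoP phiE.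
exact: (ind_weak_action hG haM hM phiE).
Qed.
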